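(* Let $n,k\ge 1$ be integers, let $0<\alpha\le k$ and let $T\subset\mathbb{R}^k$ be an Ahlfors--David $\alpha$-regular set. Let $B\subset T\times\mathbb{R}^n$ be a Borel set and assume that $0<\beta\le n$ is a real number such that $\dim B_t\le\beta$ for all $t\in T$. Then there exists a $\Gamma_\alpha$-null Borel set $G\subset B$ such that $\dim(B\setminus G)\le\alpha+\beta$.
   Context: $\dim$ denotes Hausdorff dimension and $\mathcal{H}^s$ the $s$-dimensional Hausdorff measure. For $B\subset\mathbb{R}^k\times\mathbb{R}^n$ and $t\in\mathbb{R}^k$, $B_t=\{x\in\mathbb{R}^n:(t,x)\in B\}$. A Borel set $T\subset\mathbb{R}^k$ is Ahlfors--David $\alpha$-regular if there are $c,c'>0$ such that $c\,r^\alpha\le\mathcal{H}^\alpha(T\cap B(t,r))\le c'\,r^\alpha$ for all $t\in T$ and $0<r\le 1$, where $B(t,r)$ is the open ball. A set $G\subset\mathbb{R}^k\times\mathbb{R}^n$ is $\Gamma_\alpha$-null if for every Lipschitz map $f:\mathbb{R}^k\to\mathbb{R}^n$ we have $\mathcal{H}^\alpha(\{t\in\mathbb{R}^k:(t,f(t))\in G\})=0$. *)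

(* Defs.v *)
From mathcomp Require Export all_boot all_order all_algebra.
From mathcomp Require Export all_classical all_reals all_analysis.
Export numFieldNormedType.Exports.

Set Implicit Arguments.
Unset Strict Implicit.
Unset Printing Implicit Defensive.

Import Order.TTheory GRing.Theory Num.Theory.

Local Open Scope classical_set_scope.
Local Open Scope ring_scope.

(* The library's norm on ['rV[R]_m] and on products is the max norm, so the
   Euclidean metric is introduced separately; it induces the same topology,
   hence the same Borel sets. *)
Definition edist (R : realType) (m : nat) (x y : 'rV[R]_m) : R :=
  Num.sqrt (\sum_(i < m) (x 0 i - y 0 i) ^+ 2).

(* Euclidean metric of R^(k+n) under the identification with R^k x R^n. *)
Definition edist_prod (R : realType) (k n : nat)
    (p q : 'rV[R]_k * 'rV[R]_n) : R :=
  Num.sqrt (edist p.1 q.1 ^+ 2 + edist p.2 q.2 ^+ 2).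

Definition eball (R : realType) (m : nat) (x : 'rV[R]_m) (r : R) :
  set 'rV[R]_m := [set y | edist x y < r].

Definition borel (X : topologicalType) (A : set X) : Prop :=
  <<s [set U : set X | open U] >> A.

Definition elipschitz (R : realType) (k n : nat) (f : 'rV[R]_k -> 'rV[R]_n) :
  Prop := exists L : R, forall x y, edist (f x) (f y) <= L * edist x y.

Section hausdorff.
Local Open Scope ereal_scope.
Context {R : realType} {X : Type} (d : X -> X -> R).

(* The maximum with 0 only matters for the empty set. *)
Definition diam (U : set X) : \bar R :=
  maxe 0 (ereal_sup [set (d x y)%:E | x in U & y in U]).

(* The empty set contributes 0 also for s = 0, whereas 0 `^ 0 = 1 for the
   diameter of a point. *)
Definition diam_pow (s : R) (U : set X) : \bar R :=
  if `[< U = set0 >] then 0 else diam U `^ s.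

Definition hausdorff_premeasure (s delta : R) (A : set X) : \bar R :=
  ereal_inf [set \sum_(0 <= i <oo) diam_pow s (F i) | F in
    [set F : (set X)^nat |
       A `<=` \bigcup_i F i /\ forall i, diam (F i) <= delta%:E]].

Definition hausdorff_measure (s : R) (A : set X) : \bar R :=
  ereal_sup [set hausdorff_premeasure s delta A | delta in
    [set delta : R | (0 < delta)%R]].

Definition hausdorff_dim (A : set X) : \bar R :=
  ereal_inf [set s%:E | s in
    [set s : R | (0 <= s)%R /\ hausdorff_measure s A = 0]].

End hausdorff.

Definition AD_regular (R : realType) (k : nat) (alpha : R)
    (T : set 'rV[R]_k) : Prop :=
  borel T /\
  exists c c' : R, [/\ 0 < c, 0 < c' &
    forall (t : 'rV[R]_k) (r : R), T t -> 0 < r -> r <= 1 ->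
      ((c * r `^ alpha)%:E <=
         hausdorff_measure (@edist R k) alpha (T `&` eball t r))%E /\
      (hausdorff_measure (@edist R k) alpha (T `&` eball t r) <=
         (c' * r `^ alpha)%:E)%E].

Definition Gamma_null (R : realType) (k n : nat) (alpha : R)
    (G : set ('rV[R]_k * 'rV[R]_n)) : Prop :=
  forall f : 'rV[R]_k -> 'rV[R]_n, elipschitz f ->
    hausdorff_measure (@edist R k) alpha [set t | G (t, f t)] = 0%E.

(* Main.v *)
From HB Require Import structures.
Require Import Defs.
From mathcomp Require Import measurable_realfun ring lra zify.

Set Implicit Arguments.
Unset Strict Implicit.
Unset Printing Implicit Defensive.

Import Order.TTheory GRing.Theory Num.Theory.

Local Open Scope classical_set_scope.
Local Open Scope ring_scope.

(* Cover each fibre B_t by dyadic cubes J, measurably in t, so that the integral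
   over t of the sum of side(J)^b is tiny (b slightly larger than beta). At scale
   2^-l, call a product cube I x J full if the set of t in I whose cover uses J has
   measure at least 2^(-l (alpha + tau)). By the fibre estimate the full cubes are
   so few that they have small H^s content for s = alpha + b + 2 tau. Conversely a
   Lipschitz graph meets boundedly many J above each I, and by regularity
   O(2^(l alpha)) cells I meet T, so the set of t over which the graph runs through
   non-full cubes of scale 2^-l has measure O(2^(-l tau)). The limsup of the unions
   of full cubes is the small part of B, and the rest of B is G.

   The measurable covers are where B being Borel matters. They come from Choquet's
   capacitability argument for the capacity that assigns to a set A in R^k x R^n
   the infimum, over measurable families of covers of the fibres of A, of the
   integral of the dyadic net content of the cover: it is continuous along
   increasing unions by strong subadditivity, it vanishes on compact sets with
   null fibres, and Borel sets are Suslin. *)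

(** * Hausdorff measures as outer measures *)

(** Covers chosen optimally for each [t] separately need not depend measurably on [t]. Minimising
    over measurable families only removes this obstacle, but then null fibres no longer give
    capacity zero for free. Measurable means Carathéodory measurable for H^alpha restricted to the
    part of [T] in a unit ball: a finite measure for which all cubes are measurable. With b = beta +
    tau every fibre is H^b-null. Of the surplus 2 tau in s, one tau makes the measures of the
    non-full cells summable over the levels, the other the content of the full cubes. One family of
    covers only gives small quantities, hence a sequence of families and a Borel-Cantelli argument
    on both sides. For fixed tau this yields dimension at most alpha + beta + 3 tau; since
    Gamma-null sets are stable under countable unions, the exceptional sets for tau = 1/(j+1) can be
    united. The same remark allows cutting [B] into bounded pieces, with bases inside a small ball
    and fibres inside one unit cell, so that the dyadic tree has a single root. *)

Lemma nneseries_uncurry (R : realType) (a : nat -> nat -> \bar R)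
    (f : nat -> nat * nat) : bijective f -> (forall i j, 0 <= a i j)%E ->
  (\sum_(m <oo) a (f m).1 (f m).2 = \sum_(i <oo) \sum_(j <oo) a i j)%E.
Proof.
move=> bf a0; rewrite nneseries_esumT//.
rewrite -(reindex_esum setT setT f (fun p => a p.1 p.2)); last first.
  by rewrite setTT_bijective.
rewrite nneseries_esumT; last by move=> i; apply: nneseries_ge0.
rewrite (eq_esum (b := fun i => \esum_(j in setT) a i j)%E); last first.
  by move=> i _; rewrite nneseries_esumT.
rewrite esum_esum//; congr (esum _ _).
by apply/seteqP; split.
Qed.

Section hausdorff_outer_measure.
Local Open Scope ereal_scope.
Context {R : realType} {X : Type} (d : X -> X -> R).
Implicit Types (s delta : R) (A B U : set X).

Lemma le_diam A B : A `<=` B -> diam d A <= diam d B.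
Proof.
move=> AB; rewrite /diam ge_max le_max lexx/= le_max; apply/orP; right.
apply: ereal_sup_le => _ [x Ax [y Ay <-]].
by exists x; [exact: AB|exists y; [exact: AB|]].
Qed.

Lemma diam0 : diam d set0 = 0.
Proof.
rewrite /diam (_ : [set _ | _ in _ & _ in _] = set0) ?ereal_sup0//.
by apply/seteqP; split=> // ? [].
Qed.

Lemma diam_ge0 A : 0 <= diam d A. Proof. by rewrite le_max lexx. Qed.

Lemma diam_le A (r : R) : (0 <= r)%R ->
  (forall x y, A x -> A y -> (d x y <= r)%R) -> diam d A <= r%:E.
Proof.
move=> r0 h; rewrite ge_max lee_fin r0/=; apply: ge_ereal_sup => _ [x Ax [y Ay <-]].
by rewrite lee_fin h.
Qed.

Lemma le_dist_diam A x y (r : R) : diam d A <= r%:E -> A x -> A y -> (d x y <= r)%R.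
Proof.
move=> + Ax Ay; rewrite ge_max => /andP[_ h]; rewrite -lee_fin.
by apply: le_trans h; apply: ereal_sup_ubound; exists x => //; exists y.
Qed.

Lemma diam_pow0 s : diam_pow d s set0 = 0.
Proof. by rewrite /diam_pow; case: asboolP. Qed.

Lemma diam_pow_ge0 s A : 0 <= diam_pow d s A.
Proof. by rewrite /diam_pow; case: asboolP => // _; exact: poweR_ge0. Qed.
Hint Resolve diam_pow_ge0 : core.

Lemma diam_pow_le s A (r : R) : (0 <= s)%R ->
  diam d A <= r%:E -> diam_pow d s A <= (r `^ s)%:E.
Proof.
move=> s0 h; rewrite /diam_pow; case: asboolP => [_|_].
  by rewrite lee_fin powR_ge0.
rewrite -poweR_EFin gt0_ler_poweR// in_itv/= ?leey ?andbT ?diam_ge0//.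
by rewrite (le_trans _ h)// diam_ge0.
Qed.

Local Notation pre := (hausdorff_premeasure d).
Local Notation H := (hausdorff_measure d).

Lemma premeasure_ge0 s delta A : 0 <= pre s delta A.
Proof. by apply: le_ereal_inf_tmp => _ [F _ <-]; exact: nneseries_ge0. Qed.
Hint Resolve premeasure_ge0 : core.

Lemma premeasure_le_cover s delta A (F : (set X)^nat) :
  A `<=` \bigcup_i F i -> (forall i, diam d (F i) <= delta%:E) ->
  pre s delta A <= \sum_(i <oo) diam_pow d s (F i).
Proof. by move=> AF dF; apply: ereal_inf_lbound; exists F. Qed.

Lemma premeasure_le_diam s delta A : (0 <= delta)%R -> diam d A <= delta%:E ->
  pre s delta A <= diam_pow d s A.
Proof.
move=> d0 dA; apply: le_trans (@premeasure_le_cover _ _ _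
  (fun i => if i is 0%N then A else set0) _ _) _.
- by move=> x Ax; exists 0%N.
- by case=> [//|i]; rewrite diam0 lee_fin.
- rewrite nneseries_recl//.
  rewrite [X in _ + X]eseries0 ?adde0//.
  by case=> [//|i] _ _; rewrite diam_pow0.
Qed.

Lemma premeasure_cover s delta A (e : R) : pre s delta A < e%:E ->
  exists F : (set X)^nat, [/\ A `<=` \bigcup_i F i,
    (forall i, diam d (F i) <= delta%:E) &
    \sum_(i <oo) diam_pow d s (F i) < e%:E].
Proof.
by move=> /ereal_inf_lt[_ [F [AF dF] <-] ?]; exists F.
Qed.

Lemma premeasure0 s delta : (0 <= delta)%R -> pre s delta set0 = 0.
Proof.
move=> d0; apply/eqP; rewrite eq_le premeasure_ge0 andbT.
by rewrite -(diam_pow0 s) premeasure_le_diam// diam0 lee_fin.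
Qed.

Lemma le_premeasure s delta A B : A `<=` B -> pre s delta A <= pre s delta B.
Proof.
move=> AB; apply: ereal_inf_le_tmp => _ [F [BF dF] <-].
by exists F => //; split => //; exact: subset_trans AB BF.
Qed.

Lemma premeasure_sigma_subadditive s delta :
  sigma_subadditive (pre s delta).
Proof.
move=> A; have [[i ioo]|] := pselect (exists i, pre s delta (A i) = +oo).
  by rewrite (nneseries_pinfty _ _ ioo)// leey.
rewrite -forallNE => Aoo.
apply/lee_addgt0Pr => e e0.
apply: le_trans (epsilon_trick xpredT (fun n => premeasure_ge0 s delta (A n)) (ltW e0)).
have /choice[G PG] : forall n, exists F : (set X)^nat, [/\ A n `<=` \bigcup_i F i,
    (forall i, diam d (F i) <= delta%:E) &
    \sum_(i <oo) diam_pow d s (F i) <= pre s delta (A n) + (e / (2 ^ n.+1)%:R)%:E].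
  move=> n; have : pre s delta (A n) \is a fin_num.
    by rewrite ge0_fin_numE// ltey; apply/eqP/Aoo.
  move=> finA; have fA := fineK finA.
  have [|F [AF dF sF]] := @premeasure_cover s delta (A n)
      (fine (pre s delta (A n)) + e / (2 ^ n.+1)%:R).
    by rewrite EFinD fA lteDl// lte_fin divr_gt0// ltr0n expn_gt0.
  by exists F; split => //; rewrite ltW// -[X in X + _]fA.
have /card_esym/ppcard_eqP[f] := card_nat2.
have bf : bijective f by exact: bijTT.
have [g fg gf] := bf.
apply: le_trans (@premeasure_le_cover _ _ _ (fun m => G (f m).1 (f m).2) _ _) _.
- move=> x [i _ Ax]; have [/(_ _ Ax)[j _ Gx] _ _] := PG i.
  by exists (g (i, j)) => //; rewrite gf.
- by move=> m; have [_ + _] := PG (f m).1; exact.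
- rewrite (nneseries_uncurry (a := fun i j => diam_pow d s (G i j)))//.
  by apply: lee_nneseries => [i _ _|i _]; [exact: nneseries_ge0|have [] := PG i].
Qed.

Lemma hausdorff_ge s delta A : (0 < delta)%R -> pre s delta A <= H s A.
Proof. by move=> d0; apply: ereal_sup_ubound; exists delta. Qed.

Lemma hausdorff_le s A x :
  (forall delta, (0 < delta)%R -> pre s delta A <= x) -> H s A <= x.
Proof. by move=> h; apply: ge_ereal_sup => _ [delta d0 <-]; exact: h. Qed.

Lemma hausdorff_measure0 s : H s set0 = 0.
Proof.
apply/eqP; rewrite eq_le (le_trans (premeasure_ge0 _ _ _) (hausdorff_ge _ _ ltr01)).
by rewrite andbT; apply: hausdorff_le => delta d0; rewrite premeasure0// ltW.
Qed.

Lemma hausdorff_measure_ge0 s A : 0 <= H s A.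
Proof. exact: le_trans (premeasure_ge0 _ _ _) (hausdorff_ge _ _ ltr01). Qed.

Lemma le_hausdorff_measure s : {homo H s : A B / A `<=` B >-> A <= B}.
Proof.
move=> A B AB; apply: hausdorff_le => delta d0.
exact: le_trans (le_premeasure _ _ AB) (hausdorff_ge _ _ d0).
Qed.

Lemma hausdorff_sigma_subadditive s : sigma_subadditive (H s).
Proof.
move=> A; apply: hausdorff_le => delta d0.
apply: le_trans (premeasure_sigma_subadditive _ _ _) _.
by apply: lee_nneseries => // i _; exact: hausdorff_ge.
Qed.

Lemma hausdorff_measure_eq0 s A :
  (forall delta e : R, (0 < delta)%R -> (0 < e)%R -> pre s delta A <= e%:E) ->
  H s A = 0.
Proof.
move=> h; apply/eqP; rewrite eq_le hausdorff_measure_ge0 andbT.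
apply: hausdorff_le => delta d0; apply/lee_addgt0Pr => e e0.
by rewrite add0e h.
Qed.

Lemma premeasure_eq0 s delta A : (0 < delta)%R -> H s A = 0 -> pre s delta A = 0.
Proof.
move=> d0 h; apply/eqP; rewrite eq_le premeasure_ge0 andbT -h.
exact: hausdorff_ge.
Qed.

Lemma hausdorff_dim_le s A : (0 <= s)%R -> H s A = 0 -> hausdorff_dim d A <= s%:E.
Proof. by move=> s0 h; apply: ereal_inf_lbound; exists s. Qed.

(** For sets of diameter at most 1 a larger exponent makes every term of the covering sum
    smaller. *)
Lemma le_premeasure_exponent s s' delta A : (0 <= s)%R -> (s <= s')%R -> (delta <= 1)%R ->
  pre s' delta A <= pre s delta A.
Proof.
move=> s0 ss d1; apply: le_ereal_inf_tmp => _ [F [AF dF] <-].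
apply: le_trans (premeasure_le_cover _ AF dF) _.
apply: lee_nneseries => // i _; rewrite /diam_pow; case: asboolP => // _.
have := dF i; have := diam_ge0 (F i); case: (diam d (F i)) => // r.
rewrite !lee_fin => r0 rd.
(* Diameter 0 is treated apart, since 0 to the power 0 is 1: either the exponents agree or [s'] is
   positive and the left side is 0. *)
move: r0; rewrite le_eqVlt => /predU1P[<-|r0].
  move: ss; rewrite le_eqVlt => /predU1P[->//|ss].
  by rewrite powR0 ?powR_ge0// gt_eqF// (le_lt_trans s0).
by apply: ger_powR => //; rewrite r0/=; exact: le_trans d1.
Qed.

Lemma hausdorff_dim_lt s A : hausdorff_dim d A < s%:E -> H s A = 0.
Proof.
move=> /ereal_inf_lt[_ [s' [s'0 Hs'] <-]]; rewrite lte_fin => ss'.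
apply: hausdorff_measure_eq0 => delta e d0 e0.
(* Comparing exponents requires diameters at most 1, hence the truncation of [delta]. *)
have m0 : (0 < Num.min delta 1)%R by rewrite lt_min d0 ltr01.
apply: (@le_trans _ _ (hausdorff_premeasure d s (Num.min delta 1)%R A)).
  apply: ereal_inf_le_tmp => _ [F [AF dF] <-]; exists F => //; split=> // i.
  by rewrite (le_trans (dF i))// lee_fin ge_min lexx.
apply: le_trans (le_premeasure_exponent _ s'0 (ltW ss') _) _.
  by rewrite ge_min lexx orbT.
by rewrite premeasure_eq0// lee_fin ltW.
Qed.

End hausdorff_outer_measure.
#[global] Hint Extern 0 (is_true (_ <= diam_pow _ _ _)%E) =>
  solve [exact: diam_pow_ge0] : core.
#[global] Hint Extern 0 (is_true (_ <= hausdorff_premeasure _ _ _ _)%E) =>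
  solve [exact: premeasure_ge0] : core.
#[global] Hint Extern 0 (is_true (_ <= hausdorff_measure _ _ _)%E) =>
  solve [exact: hausdorff_measure_ge0] : core.

Lemma outer_measure_bigsetU (R : realType) (X I : Type) (mu : {outer_measure set X -> \bar R})
    (s : seq I) (F : I -> set X) :
  (mu (\big[setU/set0]_(i <- s) F i) <= \sum_(i <- s) mu (F i))%E.
Proof.
elim/big_ind2 : _ => //; first by rewrite outer_measure0.
by move=> A x B y Ax By; apply: le_trans (leeD Ax By); exact: outer_measureU2.
Qed.

(** * Carathéodory's criterion for sublevel sets *)

Section caratheodory_criterion.
Local Open Scope ereal_scope.
Context {R : realType} {X : Type} (mu : {outer_measure set X -> \bar R}).
Variable phi : X -> R.
Hypothesis additive_gap : forall (A B : set X) (r : R), (0 < r)%R ->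
  (forall x y, A x -> B y -> (phi x + r <= phi y)%R) -> mu A + mu B <= mu (A `|` B).

(* The layers [R i] between consecutive levels accumulating at [a] have a
   summable measure, because layers of the same parity are separated. *)
Lemma caratheodory_sublevel (a : R) : mu.-caratheodory [set x | phi x < a]%R.
Proof.
apply: le_caratheodory_measurable => E.
set W := [set x | phi x < a]%R.
have [->|Efin] := eqVneq (mu E) +oo; first by rewrite leey.
pose b i : R := (a - i.+1%:R^-1)%R.
have bS i : (b i < b i.+1)%R.
  by rewrite /b ltrD2l ltrN2 ltf_pV2 ?posrE ?ltr0n// ltr_nat.
have ba i : (b i < a)%R by rewrite /b ltrBlDr ltrDl invr_gt0 ltr0n.
pose A i := E `&` [set x | phi x < b i]%R.
pose L i := E `&` [set x | b i <= phi x < b i.+1]%R.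
have AE i : mu (A i) <= mu E by apply: le_outer_measure => x [].
have Afin i : mu (A i) \is a fin_num.
  rewrite ge0_fin_numE ?outer_measure_ge0// (le_lt_trans (AE i))//.
  by rewrite ltey.
have stepA i : mu (L i.+1) + mu (A i) <= mu (A i.+2).
  rewrite addeC; apply: le_trans (additive_gap (r := (b i.+1 - b i)%R) _ _) _.
  - by rewrite subr_gt0.
  - by move=> x y [_ /= xb] [_ /= /andP[yb _]]; lra.
  - apply: le_outer_measure => x [[Ex /= xb]|[Ex /= /andP[_ xb]]]; split => //=.
    by apply: (lt_trans xb); apply: (lt_trans (bS _)).
(* A layer leads from [A N] to [A N.+2]; keeping two consecutive terms on the right lets both
   parities telescope at once. *)
have sumL N : \sum_(0 <= i < N) mu (L i.+1) + (mu (A 0%N) + mu (A 1%N)) <=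
    mu (A N) + mu (A N.+1).
  elim: N => [|N ih]; first by rewrite big_geq// add0e.
  rewrite big_nat_recr//= addeAC (le_trans (leeD2r _ ih))//.
  rewrite addeC addeA [X in X <= _](_ : _ = mu (A N.+1) + (mu (L N.+1) + mu (A N))).
    by rewrite leeD2l.
  by rewrite addeC.
have tailL : \sum_(j <= i <oo) mu (L i.+1) @[j --> \oo] --> 0.
  apply: nneseries_tail_cvg => //; last by move=> k _; exact: outer_measure_ge0.
  apply: (@le_lt_trans _ _ (mu E + mu E)); last by rewrite lte_add_pinfty// ltey.
  apply: lime_le; first by apply: is_cvg_nneseries => k _ _; exact: outer_measure_ge0.
  apply: nearW => N; apply: (@le_trans _ _ (mu (A N) + mu (A N.+1))).
    by apply: le_trans (sumL N); rewrite leeDl// adde_ge0// outer_measure_ge0.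
  by rewrite leeD.
(* [A j.+1] is separated from the complement of the sublevel set, and the layers from there on make
   up the rest of [E] below level [a]. *)
have split j : mu (E `&` W) + mu (E `&` ~` W) <= mu E + \sum_(j <= i <oo) mu (L i.+1).
  have EW : mu (E `&` W) <= mu (A j.+1) + \sum_(j <= i <oo) mu (L i.+1).
    rewrite -nneseries_addn; last by move=> i; exact: outer_measure_ge0.
    apply: (@le_trans _ _ (mu (A j.+1 `|` \bigcup_i L (i + j).+1))).
      apply: le_outer_measure => x [Ex Wx].
      have [xj|jx] := ltP (phi x) (b j.+1); first by left.
      right.
      have [N xN] : exists N, (phi x < b (N + j.+1)%N)%R.
        have ax : (0 < a - phi x)%R by rewrite subr_gt0.
        exists (Num.truncn (a - phi x)^-1)%R.
        rewrite /b ltrBrDr -ltrBrDl invf_plt ?posrE ?ltr0n//.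
        apply: (lt_le_trans (Num.Theory.truncnS_gt _)).
        by rewrite ler_nat ltnS leq_addr.
      elim: N xN => [|N ih] xN; first by rewrite add0n ltNge jx in xN.
      have [/ih//|h] := ltP (phi x) (b (N + j.+1)%N).
      exists N => //; split => //=.
      by rewrite -addnS h.
    apply: le_trans (outer_measureU2 _ _ _) _.
    by rewrite leeD2l//; exact: (outer_measure_sigma_subadditive mu).
  have AW : mu (A j.+1) + mu (E `&` ~` W) <= mu E.
    apply: le_trans (additive_gap (r := (a - b j.+1)%R) _ _) _.
    - by rewrite subr_gt0.
    - by move=> x y [_ /= xb] [_ /= /negP]; rewrite -leNgt; lra.
    - by apply: le_outer_measure => x [[]|[]].
  apply: le_trans (leeD2r _ EW) _.
  by rewrite addeAC leeD2r.
have tailE : mu E + \sum_(j <= i <oo) mu (L i.+1) @[j --> \oo] --> mu E + 0.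
  apply: cvgeD => //; last exact: cvg_cst.
  by rewrite fin_num_adde_defl.
rewrite -[leRHS]adde0 -(cvg_lim _ tailE)//; apply: lime_ge; last exact: nearW.
by apply/cvg_ex; exists (mu E + 0).
Qed.

End caratheodory_criterion.

Section restricted_hausdorff.
Local Open Scope ereal_scope.
Context {R : realType} {X : Type} (d : X -> X -> R) (s : R).

Lemma le_premeasure_delta delta delta' (A : set X) : (delta <= delta')%R ->
  hausdorff_premeasure d s delta' A <= hausdorff_premeasure d s delta A.
Proof.
move=> dd; apply: ereal_inf_le_tmp => _ [F [AF dF] <-].
by exists F => //; split=> // i; rewrite (le_trans (dF i)).
Qed.

(** A covering set of diameter less than [r] cannot meet both [A] and [B], so a fine cover of the
    union splits into one cover of each. *)
Lemma hausdorff_measure_separated (A B : set X) (r : R) : (0 < r)%R ->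
  (forall x y, A x -> B y -> (r <= d x y)%R) ->
  hausdorff_measure d s A + hausdorff_measure d s B <= hausdorff_measure d s (A `|` B).
Proof.
move=> r0 AB.
have pAB delta : (delta < r)%R -> hausdorff_premeasure d s delta A +
    hausdorff_premeasure d s delta B <= hausdorff_premeasure d s delta (A `|` B).
  move=> dr; apply: le_ereal_inf_tmp => _ [F [ABF dF] <-].
  pose m i := `[< exists2 x, F i x & A x >].
  rewrite (eq_eseriesr (g := fun i => diam_pow d s (if m i then F i else set0) +
    diam_pow d s (if m i then set0 else F i))); last first.
    by move=> i _; case: (m i); rewrite diam_pow0 ?adde0 ?add0e.
  rewrite nneseriesD//; apply: leeD.
  - apply: (@premeasure_le_cover _ _ d s delta A (fun i => if m i then F i else set0)) => [x Ax|i].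
      have [i _ Fx] := ABF x (or_introl Ax); exists i => //.
      by rewrite /m; case: asboolP => // -[]; exists x.
    by case: (m i) => //; exact: le_trans (le_diam d (@sub0set _ (F i))) (dF i).
  - apply: (@premeasure_le_cover _ _ d s delta B (fun i => if m i then set0 else F i)) => [y By|i].
      have [i _ Fy] := ABF y (or_intror By); exists i => //.
      rewrite /m; case: asboolP => // -[x Fx Ax].
      have := le_dist_diam (dF i) Fx Fy; have := AB _ _ Ax By; lra.
    by case: (m i) => //; exact: le_trans (le_diam d (@sub0set _ (F i))) (dF i).
have [->|fin] := eqVneq (hausdorff_measure d s (A `|` B)) +oo; first by rewrite leey.
(* The two suprema run over independent scales; both scales are lowered to a common one below [r],
   which only increases the premeasures. *)
have key d1 d2 : (0 < d1)%R -> (0 < d2)%R -> hausdorff_premeasure d s d1 A +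
    hausdorff_premeasure d s d2 B <= hausdorff_measure d s (A `|` B).
  move=> d10 d20; pose d3 := (Num.min (r / 2) (Num.min d1 d2))%R.
  have d30 : (0 < d3)%R by rewrite !lt_min d10 d20 andbT divr_gt0.
  apply: le_trans (hausdorff_ge d s (A `|` B) d30).
  apply: le_trans (pAB _ _); last first.
    rewrite (@le_lt_trans _ _ (r / 2)%R)//; first by rewrite ge_min lexx.
    by lra.
  by apply: leeD; apply: le_premeasure_delta; rewrite /d3 !ge_min lexx ?orbT.
have finU : hausdorff_measure d s (A `|` B) \is a fin_num.
  by rewrite ge0_fin_numE ?ltey// hausdorff_measure_ge0.
have finH C : C `<=` A `|` B -> hausdorff_measure d s C \is a fin_num.
  move=> CAB; rewrite ge0_fin_numE ?hausdorff_measure_ge0//.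
  rewrite (le_lt_trans (le_hausdorff_measure d s CAB))//.
  by rewrite ltey.
have finA := finH A (@subsetUl _ _ _).
have finP d2 : (0 < d2)%R -> hausdorff_premeasure d s d2 B \is a fin_num.
  move=> d20; rewrite ge0_fin_numE ?premeasure_ge0//.
  rewrite (le_lt_trans (hausdorff_ge d s B d20))//.
  by rewrite -ge0_fin_numE ?hausdorff_measure_ge0//; apply: finH; exact: subsetUr.
rewrite addeC -leeBrDr//; apply: hausdorff_le => d2 d20.
rewrite leeBrDr// addeC -leeBrDr ?finP//; apply: hausdorff_le => d1 d10.
by rewrite leeBrDr ?finP// key.
Qed.

(** For 0 < s <= k the measure H^s of the whole of R^k is infinite; restricted to a regular set
    inside a unit ball it becomes finite, as the integrals below require. *)
Definition hausdorff_restr (T : set X) : set X -> \bar R :=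
  fun A => hausdorff_measure d s (A `&` T).

Lemma hausdorff_restr_sigma_subadditive T :
  sigma_subadditive (hausdorff_restr T).
Proof.
move=> F; rewrite /hausdorff_restr setI_bigcupl.
exact: hausdorff_sigma_subadditive.
Qed.

Lemma hausdorff_restr0 T : hausdorff_restr T set0 = 0.
Proof. by rewrite /hausdorff_restr set0I hausdorff_measure0. Qed.

Lemma hausdorff_restr_ge0 T A : 0 <= hausdorff_restr T A.
Proof. exact: hausdorff_measure_ge0. Qed.

Lemma le_hausdorff_restr T :
  {homo hausdorff_restr T : A B / A `<=` B >-> A <= B}.
Proof. by move=> A B AB; apply: le_hausdorff_measure; exact: setSI. Qed.

HB.instance Definition _ T := isOuterMeasure.Build R X (hausdorff_restr T)
  (hausdorff_restr0 T) (hausdorff_restr_ge0 T) (@le_hausdorff_restr T)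
  (@hausdorff_restr_sigma_subadditive T).

(** A gap between levels of a 1-Lipschitz function is a gap in distance. Applied to the coordinates
    and their opposites, this makes cubes and dyadic cells measurable. *)
Lemma caratheodory_hausdorff_sublevel (T : set X) (phi : X -> R) (a : R) :
  (forall x y, `|phi x - phi y| <= d x y)%R ->
  (hausdorff_restr T).-caratheodory [set x | phi x < a]%R.
Proof.
move=> phid; apply: (@caratheodory_sublevel R X (hausdorff_restr T)).
move=> A B r r0 AB; rewrite /= /hausdorff_restr setIUl.
apply: (@hausdorff_measure_separated _ _ r) => // x y [Ax _] [By _].
by rewrite (le_trans _ (phid x y))// distrC ler_normr; apply/orP; left; have := AB _ _ Ax By; lra.
Qed.

End restricted_hausdorff.

Section premeasure_outer.
Context {R : realType} {X : Type} (d : X -> X -> R) (s : R).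

(** At a negative scale even the empty set has no admissible cover; carrying the sign of the scale
    in the type gives an outer measure structure at every scale. *)
Definition posnum_premeasure (delta : {posnum R}) : set X -> \bar R :=
  hausdorff_premeasure d s delta%:num.

Let posnum_premeasure0 delta : posnum_premeasure delta set0 = 0%E.
Proof. exact: premeasure0. Qed.

HB.instance Definition _ delta := isOuterMeasure.Build R X (posnum_premeasure delta)
  (posnum_premeasure0 delta) (fun A => premeasure_ge0 d s delta%:num A)
  (@le_premeasure R X d s delta%:num) (@premeasure_sigma_subadditive R X d s delta%:num).

End premeasure_outer.

Section hausdorff_caratheodory.
Context {R : realType} {X : pointedType} (d : X -> X -> R) (s : R) (T : set X).

Definition hausdorff_outer : {outer_measure set X -> \bar R} := hausdorff_restr d s T.

Definition hausdorff_cara :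
  {measure set (caratheodory_type hausdorff_outer) -> \bar R} := hausdorff_outer.

Lemma hausdorff_caraE A : hausdorff_cara A = hausdorff_measure d s (A `&` T).
Proof. by []. Qed.

End hausdorff_caratheodory.

(** * The capacity of measurable families of dyadic covers *)

Section net_content.
Context {dY : measure_display} {Y : measurableType dY} {R : realType}.
Variables (N : Type) (L : finType) (ch : L -> N -> N) (wt : N -> R).
Hypothesis wt_ge0 : forall w, 0 <= wt w.
Hypothesis wt_ch : forall w, wt w <= \sum_e wt (ch e w).
Implicit Types D : N -> set Y.

(* [D w] is the set of parameters whose cover contains the cube [w]; the content
   of the cover inside [w] is computed looking only [d] levels below [w]. *)
Fixpoint net_content d D w (y : Y) : R :=
  if d is d'.+1 then Num.min (wt w) (\sum_e net_content d' D (ch e w) y)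
  else wt w * \1_(D w) y.

(** Covers are recorded saturated downwards, so that two covers of the same point share all
    sufficiently small cubes around it. *)
Definition hereditary D := forall e w, D w `<=` D (ch e w).

Lemma net_content_ge0 d D w y : 0 <= net_content d D w y.
Proof.
elim: d w => [|d ih] w /=; first by rewrite mulr_ge0.
by rewrite le_min wt_ge0/= sumr_ge0.
Qed.

Lemma net_content_le_wt d D w y : net_content d D w y <= wt w.
Proof.
case: d => [|d] /=; last by rewrite ge_min lexx.
by rewrite ler_piMr// indicE; case: (_ \in _).
Qed.

Lemma le_net_content d D D' w y : (forall v, D v `<=` D' v) ->
  net_content d D w y <= net_content d D' w y.
Proof.
move=> DD; elim: d w => [|d ih] w /=.
  rewrite ler_wpM2l// !indicE ler_nat.
  by have [/set_mem/DD/mem_set->|] := boolP (y \in D w).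
by rewrite le_min ge_min lexx/= ge_min ler_sum ?orbT.
Qed.

(** Truncation preserves submodularity: u + i <= s + s' with i <= s and i <= s' remains true after
    taking the minimum of each term with [wt w]. *)
Lemma net_content_submodular d D D' w y :
  net_content d (fun v => D v `|` D' v) w y +
  net_content d (fun v => D v `&` D' v) w y <=
  net_content d D w y + net_content d D' w y.
Proof.
elim: d w => [|d ih] w /=.
  rewrite -!mulrDr ler_wpM2l// !indicE in_setU in_setI.
  by case: (_ \in _); case: (_ \in _); rewrite /= ?addr0 ?add0r.
set u := \sum_e _; set i := \sum_e _; set s := \sum_e _; set s' := \sum_e _.
have h : u + i <= s + s' by rewrite -!big_split; apply: ler_sum => e _; exact: ih.
have is_ : i <= s by apply: ler_sum => e _; apply: le_net_content => v z [].
have is' : i <= s' by apply: ler_sum => e _; apply: le_net_content => v z [].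
by case: (leP (wt w) u); case: (leP (wt w) i); case: (leP (wt w) s);
  case: (leP (wt w) s'); lra.
Qed.

(** Looking deeper can discover more of the cover but cannot make a covered cube cheaper: by
    heredity all its children are covered, and together they weigh at least as much. *)
Lemma net_contentS d D w y : hereditary D ->
  net_content d D w y <= net_content d.+1 D w y.
Proof.
move=> hD; elim: d w => [|d ih] w; last first.
  rewrite [leLHS]/= [leRHS]/= le_min ge_min lexx/= ge_min; apply/orP; right.
  by apply: ler_sum => e _; exact: ih.
rewrite /= le_min; apply/andP; split.
  by rewrite ler_piMr// indicE; case: (_ \in _).
rewrite indicE; have [/set_mem yD|_] := boolP (y \in D w); last first.
  by rewrite mulr0 sumr_ge0// => e _; rewrite mulr_ge0.
rewrite mulr1 (le_trans (wt_ch w))// ler_sum// => e _.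
by rewrite indicE mem_set ?mulr1//; exact: hD.
Qed.

Lemma net_content_nd d d' D w y : hereditary D -> (d <= d')%N ->
  net_content d D w y <= net_content d' D w y.
Proof.
move=> hD /subnK <-; elim: (d' - d)%N => // i ih.
by rewrite addSn (le_trans ih)// net_contentS.
Qed.

(** At a fixed depth only finitely many cubes matter, and the membership of [y] in each of their
    sets stabilises. *)
Lemma net_content_cvg d (D : nat -> N -> set Y) w y :
  (forall v, nondecreasing_seq (D^~ v)) ->
  \forall n \near \oo,
    net_content d (D n) w y = net_content d (fun v => \bigcup_i D i v) w y.
Proof.
move=> ndD; elim: d w => [|d ih] w /=.
  have [[i _ yD]|yD] := pselect ((\bigcup_i D i w) y).
    exists i => // n /= ni; rewrite !indicE !mem_set//; first by exists i.
    by have /subsetPset := ndD w _ _ ni; exact.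
  by apply: nearW => n; rewrite !indicE !memNset// => yDn; apply: yD; exists n.
have : \forall n \near \oo, forall e, net_content d (D n) (ch e w) y =
    net_content d (fun v => \bigcup_i D i v) (ch e w) y.
  by apply: filter_forall => e; exact: ih.
apply: filterS => n h; congr Num.min; apply: eq_bigr => e _; exact: h.
Qed.

Lemma measurable_net_content d D w : (forall v, measurable (D v)) ->
  measurable_fun setT (net_content d D w).
Proof.
move=> mD; elim: d w => [|d ih] w /=.
  by apply: measurable_funM => //; exact: measurable_indic.
apply: measurable_minr => //; apply: measurable_sum => e; exact: ih.
Qed.

Variables (mu : {measure set Y -> \bar R}) (root : N).
Hypothesis mu_fin : (mu setT < +oo)%E.

Definition net_integral d D : R := fine (\int[mu]_y (net_content d D root y)%:E).

Let mass := wt root * fine (mu setT).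

Let mEFin d D w : (forall v, measurable (D v)) ->
  measurable_fun setT (fun y => (net_content d D w y)%:E).
Proof. by move=> mD; apply/measurable_EFinP; exact: measurable_net_content. Qed.

Let integral_le d D : (forall v, measurable (D v)) ->
  (\int[mu]_y (net_content d D root y)%:E <= mass%:E)%E.
Proof.
move=> mD; apply: (@le_trans _ _ (\int[mu]_y (cst (wt root)%:E y))%E).
  apply: ge0_le_integral => //.
  - by move=> y _; rewrite lee_fin net_content_ge0.
  - exact: mEFin.
  - by move=> y _; rewrite lee_fin net_content_le_wt.
by rewrite integral_cst// EFinM fineK// ge0_fin_numE.
Qed.

Lemma net_integralE d D : (forall v, measurable (D v)) ->
  (\int[mu]_y (net_content d D root y)%:E = (net_integral d D)%:E)%E.
Proof.
move=> mD; rewrite /net_integral fineK// ge0_fin_numE.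
  exact: le_lt_trans (integral_le d mD) (ltry _).
by apply: integral_ge0 => y _; rewrite lee_fin net_content_ge0.
Qed.

Definition admissible D := (forall v, measurable (D v)) /\ hereditary D.

Lemma admissibleU D D' : admissible D -> admissible D' ->
  admissible (fun v => D v `|` D' v).
Proof.
move=> [mD hD] [mD' hD']; split=> [v|e w]; first exact: measurableU.
exact: setUSS.
Qed.

Lemma admissibleI D D' : admissible D -> admissible D' ->
  admissible (fun v => D v `&` D' v).
Proof.
move=> [mD hD] [mD' hD']; split=> [v|e w]; first exact: measurableI.
exact: setISS.
Qed.

Lemma admissible_bigcup (D : nat -> N -> set Y) : (forall i, admissible (D i)) ->
  admissible (fun v => \bigcup_i D i v).
Proof.
move=> aD; split=> [v|e w y [i _ yD]].
  by apply: bigcupT_measurable => i; have [] := aD i.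
by exists i => //; have [_ h] := aD i; exact: h yD.
Qed.

Lemma admissibleT : admissible (fun=> setT).
Proof. by []. Qed.

Lemma net_integral_ge0 d D : 0 <= net_integral d D.
Proof.
by apply: fine_ge0; apply: integral_ge0 => y _; rewrite lee_fin net_content_ge0.
Qed.

Lemma net_integral_le d D : admissible D -> net_integral d D <= mass.
Proof. by move=> [mD _]; rewrite -lee_fin -net_integralE// integral_le. Qed.

Lemma net_integral_nd d d' D : admissible D -> (d <= d')%N ->
  net_integral d D <= net_integral d' D.
Proof.
move=> [mD hD] dd; rewrite -lee_fin -!net_integralE//.
apply: ge0_le_integral => //.
- by move=> y _; rewrite lee_fin net_content_ge0.
- exact: mEFin.
- exact: mEFin.
- by move=> y _; rewrite lee_fin net_content_nd.
Qed.

Lemma net_integral_submodular d D D' : admissible D -> admissible D' ->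
  net_integral d (fun v => D v `|` D' v) + net_integral d (fun v => D v `&` D' v)
  <= net_integral d D + net_integral d D'.
Proof.
move=> aD aD'; have [mU _] := admissibleU aD aD'; have [mI _] := admissibleI aD aD'.
have [[mD _] [mD' _]] := (aD, aD').
rewrite -lee_fin !EFinD -!net_integralE// -!ge0_integralD//;
  try exact: mEFin; try by move=> y _; rewrite lee_fin net_content_ge0.
apply: ge0_le_integral => //.
- by move=> y _; rewrite -EFinD lee_fin addr_ge0// net_content_ge0.
- by apply: emeasurable_funD; exact: mEFin.
- by apply: emeasurable_funD; exact: mEFin.
- by move=> y _; rewrite -!EFinD lee_fin net_content_submodular.
Qed.

Lemma net_integral_bigcup_le d (D : nat -> N -> set Y) c :
  (forall i, admissible (D i)) -> (forall v, nondecreasing_seq (D^~ v)) ->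
  (forall i, net_integral d (D i) <= c) ->
  net_integral d (fun v => \bigcup_i D i v) <= c.
Proof.
move=> aD ndD Dc; have [mU _] := admissible_bigcup aD.
rewrite -lee_fin -net_integralE//.
rewrite (eq_integral (fun y => limn (fun i => (net_content d (D i) root y)%:E))); last first.
  move=> y _; apply/esym; apply: lim_near_cst => //.
  by have := net_content_cvg d root y ndD; apply: filterS => n ->.
rewrite monotone_convergence//.
- apply: lime_le; last by apply: nearW => i; rewrite net_integralE ?lee_fin//; have [] := aD i.
  apply: ereal_nondecreasing_is_cvgn => i j ij.
  apply: ge0_le_integral => //.
  + by move=> y _; rewrite lee_fin net_content_ge0.
  + by apply: mEFin; have [] := aD i.
  + by apply: mEFin; have [] := aD j.
  + move=> y _; rewrite lee_fin le_net_content// => v.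
    by apply/subsetPset; exact: ndD.
- by move=> i; apply: mEFin; have [] := aD i.
- by move=> i y _; rewrite lee_fin net_content_ge0.
- move=> y _ i j ij; rewrite lee_fin le_net_content// => v.
  by apply/subsetPset; exact: ndD.
Qed.

(** The integrals increase with the depth, so this is the integral of the limiting net content,
    obtained without forming the limit. *)
Definition net_cost D : R := sup [set net_integral d D | d in setT].

Lemma net_integral_le_cost d D : admissible D -> net_integral d D <= net_cost D.
Proof.
move=> aD; apply: ub_le_sup; last by exists d.
by exists mass => _ [d' _ <-]; exact: net_integral_le.
Qed.

Lemma net_cost_le D c : (forall d, net_integral d D <= c) -> net_cost D <= c.
Proof.
move=> h; apply: ge_sup; first by exists (net_integral 0 D); exists 0%N.
by move=> _ [d _ <-].
Qed.

Lemma net_cost_ge0 D : admissible D -> 0 <= net_cost D.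
Proof.
by move=> aD; rewrite (le_trans (net_integral_ge0 0 D))// net_integral_le_cost.
Qed.

Lemma net_cost_submodular D D' : admissible D -> admissible D' ->
  net_cost (fun v => D v `|` D' v) + net_cost (fun v => D v `&` D' v)
  <= net_cost D + net_cost D'.
Proof.
move=> aD aD'; have aU := admissibleU aD aD'; have aI := admissibleI aD aD'.
rewrite -lerBrDr; apply: net_cost_le => d.
rewrite lerBrDl -lerBrDr; apply: net_cost_le => d'; rewrite lerBrDr.
(* The suprema for union and intersection are approached at different depths; monotonicity moves
   both to the larger one. *)
apply: le_trans (_ : net_integral (maxn d d') D + net_integral (maxn d d') D' <= _).
  rewrite addrC; apply: le_trans (net_integral_submodular _ aD aD').
  by apply: lerD; apply: net_integral_nd => //; rewrite leq_max leqnn ?orbT.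
by apply: lerD; exact: net_integral_le_cost.
Qed.

Variables (P : Type) (cell : nat -> P -> N).
Hypothesis cellS : forall l x, exists e, cell l.+1 x = ch e (cell l x).

Definition net_covers D (A : set (Y * P)) :=
  forall p, A p -> exists l, D (cell l p.2) p.1.

Lemma hereditary_cell D l l' x : hereditary D -> (l <= l')%N ->
  D (cell l x) `<=` D (cell l' x).
Proof.
move=> hD /subnK <-; elim: (l' - l)%N => // i ih y /ih yD.
by rewrite addSn; have [e ->] := cellS (i + l) x; exact: hD yD.
Qed.

(** Two cubes containing the same point are nested, and by heredity the smaller one belongs to both
    covers. Strong subadditivity becomes useful because of this. *)
Lemma net_coversI D D' A : admissible D -> admissible D' ->
  net_covers D A -> net_covers D' A -> net_covers (fun v => D v `&` D' v) A.
Proof.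
move=> [_ hD] [_ hD'] DA DA' p Ap.
have [[l yl] [l' yl']] := (DA p Ap, DA' p Ap).
exists (maxn l l'); split.
- by apply: (hereditary_cell (l := l)) => //; rewrite leq_max leqnn.
- by apply: (hereditary_cell (l := l')) => //; rewrite leq_max leqnn orbT.
Qed.

Definition net_capacity A : R :=
  inf [set net_cost D | D in [set D | admissible D /\ net_covers D A]].

Lemma net_capacity_le D A : admissible D -> net_covers D A ->
  net_capacity A <= net_cost D.
Proof.
move=> aD DA; apply: ge_inf; last by exists D.
by exists 0 => _ [D' [aD' _] <-]; exact: net_cost_ge0.
Qed.

Lemma net_capacity_adherent A (e : R) : 0 < e ->
  exists2 D, admissible D /\ net_covers D A & net_cost D < net_capacity A + e.
Proof.
move=> e0; have [|_ [D DA <-] h] := @inf_adherent R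
  [set net_cost D | D in [set D | admissible D /\ net_covers D A]] _ e0.
  split; last by exists 0 => _ [D' [aD' _] <-]; exact: net_cost_ge0.
  exists (net_cost (fun=> setT)); exists (fun=> setT) => //.
  by split; [exact: admissibleT|move=> p _; exists 0%N].
by exists D.
Qed.

Lemma le_net_capacity A A' : A `<=` A' -> net_capacity A <= net_capacity A'.
Proof.
move=> AA; apply/ler_addgt0Pr => e /(net_capacity_adherent A')[D [aD DA] h].
apply: le_trans (ltW h); apply: net_capacity_le => // p Ap.
by apply: DA; exact: AA.
Qed.

(* Choquet's argument: strong subadditivity keeps the union of nearly optimal
   covers of [A 0], ..., [A n] nearly optimal for [A n]. *)
Lemma net_capacity_bigcup_le (A : nat -> set (Y * P)) c :
  nondecreasing_seq A -> (forall n, net_capacity (A n) <= c) ->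
  net_capacity (\bigcup_n A n) <= c.
Proof.
move=> ndA Ac; apply/ler_addgt0Pr => e e0.
pose eps n : R := e / (2 ^ n.+1)%:R.
have eps0 n : 0 < eps n by rewrite divr_gt0// ltr0n expn_gt0.
have /choice[V VP] : forall n, exists D, (admissible D /\ net_covers D (A n)) /\
    net_cost D < net_capacity (A n) + eps n.
  by move=> n; have [D] := net_capacity_adherent (A n) (eps0 n); exists D.
pose W := fix W n := if n is n'.+1 then fun v => W n' v `|` V n v else V 0%N.
have aW n : admissible (W n).
  elim: n => [|n ih]; first by have [[]] := VP 0%N.
  by apply: admissibleU => //; have [[]] := VP n.+1.
have VW n v : V n v `<=` W n v.
  by case: n => //= n; exact: subsetUr.
have ndW v : nondecreasing_seq (W^~ v).
  apply/nondecreasing_seqP => n; apply/subsetPset; exact: subsetUl.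
(* The intersection of [W n] and [V n.+1] still covers [A n], so it costs at least
   [net_capacity (A n)]; in the submodular inequality this cancels the capacity of the previous step
   and only one more [eps] remains. *)
have Wc n : net_cost (W n) <= net_capacity (A n) + \sum_(0 <= i < n.+1) eps i.
  elim: n => [|n ih].
    by rewrite big_nat1; have [_ /ltW] := VP 0%N.
  have [[aV AV] cV] := VP n.+1.
  have h1 := net_cost_submodular (aW n) aV.
  have h2 : net_capacity (A n) <= net_cost (fun v => W n v `&` V n.+1 v).
    apply: net_capacity_le; first exact: admissibleI.
    apply: net_coversI => // p Ap.
      have [[_ /(_ p Ap)[l yl]] _] := VP n.
      by exists l; exact: VW.
    by apply: AV; have /subsetPset := ndA _ _ (leqnSn n); exact.
  rewrite big_nat_recr//=.
  move: h1 h2 ih cV; rewrite /=.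
  move: (net_cost (fun v => W n v `|` V n.+1 v)) => c1.
  move: (net_cost (fun v => W n v `&` V n.+1 v)) => c2.
  move: (net_cost (W n)) (net_cost (V n.+1)) => c3 c4.
  move: (\sum_(0 <= i < n.+1) eps i) => c5; lra.
have sume n : \sum_(0 <= i < n) eps i <= e.
  rewrite (_ : \sum_(0 <= i < n) eps i = e * (1 - (2 ^ n)%:R^-1)).
    by rewrite ler_piMr ?ltW// lerBlDr lerDl.
  elim: n => [|n ih]; first by rewrite big_geq// expn0 invr1 subrr mulr0.
  rewrite big_nat_recr//= ih /eps -mulrDr; congr (_ * _).
  by rewrite expnS natrM; field; rewrite pnatr_eq0 -lt0n expn_gt0.
apply: le_trans (net_capacity_le (admissible_bigcup aW) _) _.
  move=> p [n _ Ap]; have [[_ /(_ p Ap)[l yl]] _] := VP n.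
  by exists l; exists n => //; exact: VW.
apply: net_cost_le => d; apply: net_integral_bigcup_le => // n.
apply: le_trans (net_integral_le_cost _ (aW n)) _.
apply: le_trans (Wc n) _; exact: lerD.
Qed.

End net_content.

(** * Maximal selected cubes *)

Section selected_nodes.
Context {dY : measure_display} {Y : measurableType dY} {R : realType}.
Variables (N : Type) (L : finType) (ch : L -> N -> N) (wt : N -> R) (par : N -> N).
Hypothesis wt_ge0 : forall w, 0 <= wt w.
Hypothesis wt_ch : forall w, wt w <= \sum_e wt (ch e w).
Hypothesis par_ch : forall e w, par (ch e w) = w.
Implicit Types D : N -> set Y.

Local Notation net_content := (net_content ch wt).

(* A cube is selected when covering it whole is optimal. The maximal selected
   cubes form a cover whose total weight is at most the net content, whereas the
   cubes of [D] itself may overlap and have infinite total weight. *)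
Definition selected D w := [set y | exists d, wt w <= net_content d D w y].

(** Abstract nodes carry no level, so the number [j] of ancestors to inspect is a parameter; set to
    the level of a dyadic cube, it reaches exactly up to the root. *)
Fixpoint selected_above D j w : set Y :=
  if j is j'.+1 then selected_above D j' (par w) `|` selected D (par w) else set0.

Definition first_selected D j w := selected D w `\` selected_above D j w.

Fixpoint descendants j w : seq N :=
  if j is j'.+1 then flatten [seq descendants j' (ch e w) | e <- enum L]
  else [:: w].

Lemma measurable_selected D w : (forall v, measurable (D v)) ->
  measurable (selected D w).
Proof.
move=> mD; rewrite (_ : selected D w = \bigcup_d (setT `&`
    (net_content d D w @^-1` [set` `[wt w, +oo[]))).
  apply: bigcupT_measurable => d; apply: measurable_net_content => //.
by apply/seteqP; split=> [y [d h]|y [d _ [_ h]]]; exists d => //;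
  move: h; rewrite /= in_itv/= andbT.
Qed.

Lemma measurable_selected_above D j w : (forall v, measurable (D v)) ->
  measurable (selected_above D j w).
Proof.
move=> mD; elim: j w => [|j ih] w /=; first exact: measurable0.
by apply: measurableU; [exact: ih|exact: measurable_selected].
Qed.

Lemma measurable_first_selected D j w : (forall v, measurable (D v)) ->
  measurable (first_selected D j w).
Proof.
by move=> mD; apply: measurableD;
  [exact: measurable_selected|exact: measurable_selected_above].
Qed.

Lemma sub_selected D w : D w `<=` selected D w.
Proof. by move=> y yD; exists 0%N; rewrite /= indicE mem_set// mulr1. Qed.

Lemma selected_above_descendants D i j w y : selected_above D i w y ->
  \sum_(v <- descendants j w) wt v * \1_(first_selected D (i + j) v) y = 0.
Proof.
elim: j i w => [|j ih] i w yw /=.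
  rewrite big_seq1 indicE memNset ?mulr0// addn0 => -[_]; exact.
rewrite big_flatten/= big_map big1// => e _; rewrite addnS -addSn.
by apply: ih; rewrite /= par_ch; left.
Qed.

(** If [w] is selected, no proper descendant is a maximal selected cube. If it is not, its content
    at each depth stays below its weight, hence equals the sum over the children, and induction
    applies. *)
Lemma sum_first_selected D i j w y : hereditary ch D ->
  ~ selected_above D i w y ->
  exists d, \sum_(v <- descendants j w) wt v * \1_(first_selected D (i + j) v) y
    <= net_content d D w y.
Proof.
move=> hD; elim: j i w => [|j ih] i w ayw.
  rewrite /= big_seq1 addn0 indicE; case: (boolP (_ \in _)) => [/set_mem[[d yd] _]|_].
    by exists d; rewrite mulr1.
  by exists 0%N; rewrite mulr0 mulr_ge0.
have [yw|yw] := pselect (selected D w y).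
  exists 0%N; rewrite /= big_flatten/= big_map big1 ?mulr_ge0// => e _.
  by rewrite addnS -addSn selected_above_descendants//= par_ch; right.
have /choice[f fP] : forall e, exists d, \sum_(v <- descendants j (ch e w))
    wt v * \1_(first_selected D (i + j.+1) v) y <= net_content d D (ch e w) y.
  move=> e; have := ih i.+1 (ch e w); rewrite addSnnS; apply.
  by rewrite /= par_ch => -[].
(* One depth that serves all the children, plus one level for [w] itself. *)
exists (\max_e f e).+1.
have ltw : net_content (\max_e f e).+1 D w y < wt w.
  by rewrite ltNge; apply/negP => h; apply: yw; exists (\max_e f e).+1.
have -> : net_content (\max_e f e).+1 D w y =
    \sum_e net_content (\max_e f e) D (ch e w) y.
  by move: ltw; rewrite /= gt_min ltxx/= => /ltW/min_idPr.
rewrite /= big_flatten/= big_map big_enum/=; apply: ler_sum => e _.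
by apply: le_trans (fP e) _; apply: net_content_nd => //; exact: leq_bigmax.
Qed.

Variables (mu : {measure set Y -> \bar R}) (root : N).
Hypothesis mu_fin : (mu setT < +oo)%E.

Lemma sum_measure_first_selected D j : admissible ch D ->
  (\sum_(v <- descendants j root) (wt v)%:E * mu (first_selected D j v)
    <= (net_cost ch wt mu root D)%:E)%E.
Proof.
move=> aD; have [mD hD] := aD.
have mf v : measurable_fun setT (fun y => (\1_(first_selected D j v) y : R)%:E).
  by apply/measurable_EFinP; apply: measurable_indic; exact: measurable_first_selected.
have mnc d : measurable_fun setT (fun y => (net_content d D root y)%:E).
  by apply/measurable_EFinP; exact: measurable_net_content.
rewrite (eq_bigr (fun v => \int[mu]_y ((wt v)%:E * (\1_(first_selected D j v) y)%:E))%E); last first.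
  move=> v _; rewrite ge0_integralZl_EFin ?integral_indic ?setIT//.
  - exact: measurable_first_selected.
rewrite -(ge0_integral_sum mu measurableT
  (f := fun v y => ((wt v)%:E * (\1_(first_selected D j v) y)%:E)%E)); last 2 first.
- by move=> v; apply: measurable_funeM.
- by move=> v y _; rewrite mule_ge0// lee_fin.
have nd y : nondecreasing_seq (fun d => (net_content d D root y)%:E).
  by move=> d d' dd; rewrite lee_fin net_content_nd.
(* The depth given by [sum_first_selected] varies with [y]; the limit over depths dominates
   everywhere, and monotone convergence returns to integrals at finite depth. *)
apply: (@le_trans _ _ (\int[mu]_y limn (fun d => (net_content d D root y)%:E))%E).
  apply: ge0_le_integral => //.
  - by move=> y _; apply: sume_ge0 => v _; rewrite mule_ge0// lee_fin.
  - by apply: emeasurable_sum => v; apply: measurable_funeM.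
  - apply: (emeasurable_fun_cvg (fun d y => (net_content d D root y)%:E)) => // y _.
    exact: ereal_nondecreasing_is_cvgn.
  - move=> y _; have [|d hd] := @sum_first_selected D 0 j root y hD; first by [].
    apply: (@le_trans _ _ (net_content d D root y)%:E).
      by under eq_bigr do rewrite -EFinM; rewrite sumEFin lee_fin.
    have /cvg_lim -> // := ereal_nondecreasing_cvgn (nd y).
    by apply: ereal_sup_ubound; exists d.
rewrite monotone_convergence//.
apply: lime_le.
  apply: ereal_nondecreasing_is_cvgn => d d' dd; apply: ge0_le_integral => //.
  - by move=> y _; rewrite lee_fin net_content_ge0.
  - by move=> y _; rewrite lee_fin net_content_nd.
- apply: nearW => d; have := net_integral_le_cost wt_ge0 root mu_fin d aD.
  by rewrite -lee_fin -net_integralE.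
- by move=> d y _; rewrite lee_fin net_content_ge0.
Qed.

End selected_nodes.

(** * Suslin sets and capacitability *)

(** König's lemma for sequences bounded by [n]. A finite segment is [good] if for every [m] it
    extends to a solution of [Q m] within the bounds below [m]; since finitely many next entries are
    allowed, one of them keeps it good. *)
Lemma koenig (n : nat -> nat) (Q : nat -> (nat -> nat) -> Prop) :
  (forall m s s', (forall i, (i < m)%N -> s i = s' i) -> Q m s -> Q m s') ->
  (forall m s, Q m.+1 s -> Q m s) ->
  (forall m, exists2 s, (forall i, (i < m)%N -> (s i <= n i)%N) & Q m s) ->
  exists s, forall m, Q m s.
Proof.
move=> Qloc Qdec Qex.
have Qdec' m m' s : (m <= m')%N -> Q m' s -> Q m s.
  by move=> /subnK <-; elim: (m' - m)%N => // i ih /Qdec.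
pose ext (t : seq nat) (s : nat -> nat) := forall i, (i < size t)%N -> s i = nth 0%N t i.
pose good t := forall m, exists s, [/\ ext t s,
  (forall i, (i < m)%N -> (s i <= n i)%N) & Q m s].
have goodS t : good t -> exists k, good (rcons t k).
  move=> gt; apply: contrapT => nex.
  have /choice[f fP] : forall k, exists m, ~ exists s, [/\ ext (rcons t k) s,
      (forall i, (i < m)%N -> (s i <= n i)%N) & Q m s].
    by move=> k; apply/existsNP => h; apply: nex; exists k.
  (* Beyond every level at which some allowed next entry fails, and large enough for the bound to
     apply to that entry. *)
  pose M := maxn (size t).+1 (\max_(k < (n (size t)).+1) f k).
  have [s [es sn Qs]] := gt M.
  have sk : (s (size t) < (n (size t)).+1)%N by rewrite ltnS sn// leq_max leqnn.
  have fM : (f (s (size t)) <= M)%N.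
    rewrite leq_max; apply/orP; right.
    exact: (leq_bigmax_cond (Ordinal sk)).
  apply: (fP (s (size t))); exists s; split.
  - move=> i; rewrite size_rcons ltnS nth_rcons leq_eqVlt => /predU1P[->|it].
      by rewrite ltnn eqxx.
    by rewrite it es.
  - by move=> i im; apply: sn; exact: leq_trans fM.
  - exact: Qdec' Qs.
have /choice[f fP] : forall t, exists k, good t -> good (rcons t k).
  move=> t; have [/goodS[k gk]|ngt] := pselect (good t); first by exists k.
  by exists 0%N.
pose S := fix S l := if l is l'.+1 then rcons (S l') (f (S l')) else [::].
have goodSl l : good (S l).
  elim: l => [m|l ih]; last exact: fP.
  by have [s sn Qs] := Qex m; exists s.
have sizeS l : size (S l) = l by elim: l => //= l; rewrite size_rcons => ->.
have nthS l i : (i < l)%N -> nth 0%N (S l) i = f (S i).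
  elim: l => // l ih; rewrite ltnS leq_eqVlt /= nth_rcons sizeS => /predU1P[->|il].
    by rewrite ltnn eqxx.
  by rewrite il ih.
exists (fun i => f (S i)) => m.
have [s [es _ Qs]] := goodSl m m.
by apply: Qloc Qs => i im; rewrite es ?sizeS// nthS.
Qed.

Section suslin.
Context {X : topologicalType}.
Implicit Types A : set X.

(** The Suslin operation on closed sets: finite sequences are encoded as infinite ones of which
    [F m] reads only the first [m] entries. *)
Definition suslin A := exists F : nat -> (nat -> nat) -> set X,
  [/\ forall m s, closed (F m s),
      forall m s s', (forall i, (i < m)%N -> s i = s' i) -> F m s = F m s' &
      A = [set x | exists s, forall m, F m s x]].

Lemma suslin_closed A : closed A -> suslin A.
Proof.
move=> cA; exists (fun _ _ => A); split=> //.
by apply/seteqP; split=> [x Ax|x [_ /(_ 0%N)]//]; exists id.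
Qed.

Lemma suslin_bigcup (A : nat -> set X) :
  (forall i, suslin (A i)) -> suslin (\bigcup_i A i).
Proof.
move=> /choice[F FP].
(* The first entry of [s] selects the set and the others feed its scheme, one level later. *)
exists (fun m s => if m is m'.+1 then F (s 0%N) m' (s \o S) else setT); split.
- move=> [|m] s; first exact: closedT.
  by have [cF _ _] := FP (s 0%N); exact: cF.
- move=> [//|m] s s' ss; rewrite -ss//.
  by have [_ lF _] := FP (s 0%N); apply: lF => i im; exact: ss.
- apply/seteqP; split=> [x [i _]|x [s sx]].
    have [_ _ ->] := FP i; move=> [s sx].
    by exists (fun j => if j is j'.+1 then s j' else i) => -[//|m]; exact: sx.
  exists (s 0%N) => //; have [_ _ ->] := FP (s 0%N).
  by exists (s \o S) => m; exact: sx m.+1.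
Qed.

(* The [i]-th set reads the subsequence of [s] indexed by the codes of the
   pairs [(i, _)]. *)
Lemma suslin_bigcap (A : nat -> set X) :
  (forall i, suslin (A i)) -> suslin (\bigcap_i A i).
Proof.
move=> /choice[F FP].
pose code (i j : nat) := pickle (i, j).
(* The condition from [F i j] is imposed only when [m] exceeds all the codes it reads, so that level
   [m] depends on the first [m] entries only. *)
pose G (m : nat) (s : nat -> nat) (i j : nat) := [set x | (forall j', (j' < j)%N -> (code i j' < m)%N) ->
  F i j (fun l => s (code i l)) x].
exists (fun m s => \bigcap_(p in setT) G m s p.1 p.2); split.
- move=> m s; apply: closed_bigI => -[i j] _ /=.
  have [h|h] := pselect (forall j', (j' < j)%N -> (code i j' < m)%N).
    rewrite (_ : G _ _ _ _ = F i j (fun l => s (code i l))).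
      by have [cF _ _] := FP i; exact: cF.
    by apply/seteqP; split=> x; [exact|move=> ? _].
  rewrite (_ : G _ _ _ _ = setT); first exact: closedT.
  by apply/seteqP; split=> x // _ /h.
- move=> m s s' ss; apply: eq_bigcapr => -[i j] _ /=.
  rewrite /G; apply/seteqP; split=> x /= h cm; have := h cm;
    have [_ lF _] := FP i; rewrite (lF j _ (fun l => s' (code i l)))// => l lj;
    by rewrite ss//; exact: cm.
- apply/seteqP; split=> [x Ax|x [s sx] i _].
    have /choice[s sP] : forall i, exists s, forall m, F i m s x.
      by move=> i; have := Ax i Logic.I; have [_ _ ->] := FP i.
    exists (fun c => if unpickle c is Some (i, j) then s i j else 0%N).
    move=> m [i j] _ _ /=; have [_ lF _] := FP i.
    by rewrite (lF _ _ (s i))// => l _; rewrite /code pickleK.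
  have [_ _ ->] := FP i; exists (fun l => s (code i l)) => j.
  apply: (sx (\max_(j' < j) (code i j').+1)%N (i, j)) => // j' j'j /=.
  exact: (leq_bigmax_cond (Ordinal j'j)).
Qed.

(** Suslin sets are not stable under complement, but the sets that are Suslin together with their
    complement form a sigma-algebra. *)
Lemma borel_suslin : (forall U : set X, open U ->
    exists2 C : nat -> set X, (forall i, closed (C i)) & U = \bigcup_i C i) ->
  forall A, borel A -> suslin A.
Proof.
move=> open_Fsigma.
have open_suslin U : open U -> suslin U.
  by move=> /open_Fsigma[C cC ->]; apply: suslin_bigcup => i; exact: suslin_closed.
suff : <<s [set U : set X | open U] >> `<=` [set A | suslin A /\ suslin (~` A)].
  by move=> h A /h[].
apply: smallest_sub; last first.
  by move=> U oU; split; [exact: open_suslin|apply: suslin_closed; exact: open_closedC].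
split.
- by rewrite /= setC0; split; apply: suslin_closed; [exact: closed0|exact: closedT].
- by move=> A [sA sCA]; rewrite /= setTD setCK.
- move=> F sF; split; first by apply: suslin_bigcup => i; have [] := sF i.
  by rewrite setC_bigcup; apply: suslin_bigcap => i; have [] := sF i.
Qed.

(** Choquet's capacitability. If the capacity of [A] exceeded [c], continuity along increasing
    unions would allow bounding the entries of the Suslin sequences one after another while staying
    above [c]. Bounded sequences yield decreasing closed sets [K m], all of capacity above [c],
    whose intersection lies in [A] by König's lemma. *)
Lemma suslin_capacity_le (R : realType) (cap : set X -> R) (c : R) (A K0 : set X) :
  {homo cap : U V / U `<=` V >-> U <= V} ->
  (forall (U : nat -> set X) b, nondecreasing_seq U -> (forall i, cap (U i) <= b) ->
    cap (\bigcup_i U i) <= b) ->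
  closed K0 -> A `<=` K0 ->
  (forall K : nat -> set X, (forall m, closed (K m)) -> (forall m, K m `<=` K0) ->
    (forall m, K m.+1 `<=` K m) -> \bigcap_m K m `<=` A ->
    exists m, cap (K m) <= c) ->
  suslin A -> cap A <= c.
Proof.
move=> le_cap cap_bigcup cK0 AK0 capK [F [cF lF AE]].
rewrite leNgt; apply/negP => cA.
(* The part of [A] reached by sequences whose first entries are bounded by [t]. Bounding an entry,
   rather than fixing it, makes these sets increase with the bound. *)
pose As (t : seq nat) := [set x | exists2 s, (forall i, (i < size t)%N ->
  (s i <= nth 0 t i)%N) & forall m, F m s x].
have capS t : c < cap (As t) -> exists k, c < cap (As (rcons t k)).
  move=> ct; apply: contrapT => /forallNP h.
  have : cap (\bigcup_k As (rcons t k)) <= c.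
    apply: cap_bigcup => [k k' kk|k]; last by rewrite leNgt; apply/negP/h.
    apply/subsetPset => x [s st sx]; exists s => // i it.
    rewrite (leq_trans (st _ _))//; first by move: it; rewrite !size_rcons.
    by rewrite !nth_rcons; case: ifP => // _; case: ifP.
  apply/negP; rewrite -ltNge (lt_le_trans ct)//; apply: le_cap => x [s st sx].
  exists (s (size t)) => //; exists s => // i; rewrite size_rcons ltnS nth_rcons.
  by rewrite leq_eqVlt => /predU1P[->|it]; [rewrite ltnn eqxx|rewrite it st].
have /choice[f fP] : forall t, exists k, c < cap (As t) -> c < cap (As (rcons t k)).
  move=> t; have [/capS[k gk]|ngt] := pselect (c < cap (As t)); first by exists k.
  by exists 0%N.
pose S := fix S l := if l is l'.+1 then rcons (S l') (f (S l')) else [::].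
have capSl l : c < cap (As (S l)).
  elim: l => [|l ih]; last exact: fP.
  apply: (lt_le_trans cA); apply: le_cap; rewrite AE => x [s sx].
  by exists s.
have sizeS l : size (S l) = l by elim: l => //= l; rewrite size_rcons => ->.
pose n i := f (S i).
have nthS l i : (i < l)%N -> nth 0%N (S l) i = n i.
  elim: l => // l ih; rewrite ltnS leq_eqVlt /= nth_rcons sizeS => /predU1P[->|il].
    by rewrite ltnn eqxx.
  by rewrite il ih.
pose K m := K0 `&` [set x | exists2 s, (forall i, (i < m)%N -> (s i <= n i)%N) &
  forall j, (j <= m)%N -> F j s x].
have [] := capK K.
- move=> m; apply: closedI => //.
  pose M := (\max_(i < m) n i).+1.
  (* [K m] is a finite union over bounded prefixes. The padding by 0 is harmless: [F j] with
     [j <= m] does not read it. *)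
  pose sig (t : {ffun 'I_m -> 'I_M}) i :=
    if insub i is Some j then nat_of_ord (t j) else 0%N.
  rewrite (_ : [set _ | _] = \bigcup_(t in [set t : {ffun 'I_m -> 'I_M} | forall i : 'I_m, (t i <= n i)%N])
      \bigcap_(j in [set j | (j <= m)%N]) F j (sig t)).
    apply: closed_bigcup; first exact: finite_finset.
    by move=> t _; apply: closed_bigI => j _; exact: cF.
  apply/seteqP; split=> [x [s sn sx]|x [t tn tx]].
    have sM (i : 'I_m) : (s i < M)%N.
      by rewrite ltnS (leq_trans (sn i (ltn_ord i)))// leq_bigmax.
    exists [ffun i => Ordinal (sM i)].
      by move=> i /=; rewrite ffunE/= sn.
    move=> j /= jm; rewrite (lF j _ s); first exact: sx.
    move=> i ij; have im := leq_trans ij jm.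
    by rewrite /sig insubT ffunE.
  exists (sig t); last by move=> j jm; exact: tx.
  by move=> i im; rewrite /sig insubT; exact: tn.
- by move=> m x [].
- move=> m x [K0x [s sn sx]]; split=> //; exists s => [i im|j jm].
    by apply: sn; exact: ltnW.
  by apply: sx; exact: leqW.
- move=> x Kx; rewrite AE.
  have [||m|s sx] := @koenig n (fun m s => forall j, (j <= m)%N -> F j s x).
  + move=> m s s' ss sx j jm; rewrite (lF j s' s); first exact: sx.
    by move=> i ij; rewrite ss//; exact: leq_trans jm.
  + by move=> m s sx j jm; apply: sx; exact: leqW.
  + by have [_ [s sn sx]] := Kx m Logic.I; exists s.
  + by exists s => m; exact: (sx m).
- move=> m; apply/negP; rewrite -ltNge (lt_le_trans (capSl m))//.
  apply: le_cap => x [s sn sx]; split; first by apply: AK0; rewrite AE; exists s.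
  by exists s => [i im|j _]; [rewrite -(nthS m)// sn ?sizeS|exact: sx].
Qed.

End suslin.

Lemma open_Fsigma (R : realType) (V : normedModType R) (U : set V) : open U ->
  exists2 C : nat -> set V, (forall i, closed (C i)) & U = \bigcup_i C i.
Proof.
move=> oU; pose C i := [set x | ball x i.+1%:R^-1 `<=` U].
exists C.
  move=> i; rewrite -openC (_ : ~` C i = \bigcup_(y in ~` U) ball y i.+1%:R^-1).
    by apply: bigcup_open => y _; exact: ball_open.
  apply/seteqP; split=> [x /= /existsNP[y /not_implyP[xy Uy]]|x [y Uy xy] h].
    by exists y => //; exact: ball_sym.
  by apply: Uy; apply: h; exact: ball_sym.
apply/seteqP; split=> [x Ux|x [i _]]; last by apply; exact: ballxx.
have /nbhs_ballP[e /= e0 he] : nbhs x U by exact: open_nbhs_nbhs.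
exists (Num.truncn e^-1) => // y xy; apply: he.
apply: le_ball xy; rewrite invf_ple ?posrE ?ltr0n//.
exact/ltW/Num.Theory.truncnS_gt.
Qed.

(** * Dyadic cells *)

Section euclidean.
Context {R : realType}.

Lemma edist_coord m (x y : 'rV[R]_m) i : `|x 0 i - y 0 i| <= edist x y.
Proof.
rewrite -sqrtr_sqr ler_wsqrtr// (bigD1 i)//= lerDl.
by apply: sumr_ge0 => j _; exact: sqr_ge0.
Qed.

Lemma edist_ge0 m (x y : 'rV[R]_m) : 0 <= edist x y.
Proof. exact: sqrtr_ge0. Qed.

Lemma edist_le m (x y : 'rV[R]_m) r : 0 <= r ->
  (forall i, `|x 0 i - y 0 i| <= r) -> edist x y <= m%:R * r.
Proof.
move=> r0 h; rewrite -[leRHS]ger0_norm ?mulr_ge0// -sqrtr_sqr ler_wsqrtr//.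
apply: (@le_trans _ _ (\sum_(i < m) r ^+ 2)).
  by apply: ler_sum => i _; rewrite -real_normK ?num_real// lerXn2r ?nnegrE.
rewrite sumr_const card_ord -[leLHS]mulr_natl exprMn ler_wpM2r ?sqr_ge0//.
by rewrite -natrX ler_nat; case: m {x y h} => // m; rewrite -mulnn leq_pmulr.
Qed.

Lemma edist_prod_le k n (p q : 'rV[R]_k * 'rV[R]_n) (a b : R) : 0 <= a -> 0 <= b ->
  edist p.1 q.1 <= a -> edist p.2 q.2 <= b -> edist_prod p q <= a + b.
Proof.
move=> a0 b0 pa pb; rewrite -[leRHS]ger0_norm ?addr_ge0// -sqrtr_sqr ler_wsqrtr//.
rewrite sqrrD -addrA [leRHS]addrC -addrA.
have : edist p.1 q.1 ^+ 2 <= a ^+ 2 by rewrite lerXn2r ?nnegrE ?edist_ge0.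
have : edist p.2 q.2 ^+ 2 <= b ^+ 2 by rewrite lerXn2r ?nnegrE ?edist_ge0.
have : 0 <= a * b by rewrite mulr_ge0.
by rewrite mulr2n; lra.
Qed.

End euclidean.

Section dyadic_cells.
Context {R : realType}.

Definition scale (l : nat) : R := 2^-1 ^+ l.

Lemma scale_gt0 l : 0 < scale l. Proof. by rewrite exprn_gt0. Qed.
Lemma scale_ge0 l : 0 <= scale l. Proof. exact/ltW/scale_gt0. Qed.
Hint Resolve scale_gt0 scale_ge0 : core.

Lemma scaleS l : scale l = 2 * scale l.+1.
Proof. by rewrite /scale exprS mulrA divff ?mul1r// pnatr_eq0. Qed.

Lemma scale_le l l' : (l <= l')%N -> scale l' <= scale l.
Proof. by move=> ll; rewrite ler_wiXn2l// invf_le1 ?ler1n. Qed.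

Lemma scale_le1 l : scale l <= 1.
Proof. by rewrite -[leRHS](expr0 2^-1) -/(scale 0) scale_le. Qed.

Lemma scale_lt (e : R) : 0 < e -> exists l, scale l < e.
Proof.
move=> e0; exists (Num.truncn e^-1); rewrite /scale exprVn invf_plt ?posrE ?exprn_gt0//.
apply: (lt_le_trans (Num.Theory.truncnS_gt _)).
by rewrite -natrX ler_nat ltn_expl.
Qed.

Lemma scale_between (q : R) : 0 < q -> q <= 1 -> exists l, scale l.+1 < q <= scale l.
Proof.
move=> q0 q1; have [l0 hl0] := scale_lt q0.
elim: l0 hl0 => [|l ih] hl; first by move: hl; rewrite /scale expr0; lra.
have [/ih//|h] := ltP (scale l) q.
by exists l; rewrite hl.
Qed.

Lemma scale_powR l (b : R) : scale l `^ b = (2^-1 `^ b) ^+ l.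
Proof.
elim: l => [|l ih]; first by rewrite /scale !expr0 powR1.
by rewrite /scale !exprS powRM ?exprn_ge0// ih.
Qed.

Definition lattice m := {ffun 'I_m -> int}.

Definition cell m (l : nat) (x : 'rV[R]_m) : lattice m :=
  [ffun i => Num.floor (2 ^+ l * x 0 i)].

Lemma scaleK l (x : R) : 2 ^+ l * x * scale l = x.
Proof. by rewrite mulrAC /scale exprVn divff ?mul1r// expf_neq0 ?pnatr_eq0. Qed.

Lemma cellP m l (x : 'rV[R]_m) (z : lattice m) :
  cell l x = z <-> forall i, (z i)%:~R * scale l <= x 0 i < (z i + 1)%:~R * scale l.
Proof.
have e i : ((z i)%:~R * scale l <= x 0 i < (z i + 1)%:~R * scale l) =
    (Num.floor (2 ^+ l * x 0 i) == z i).
  by rewrite Num.Theory.floor_eq -[in LHS](scaleK l (x 0 i)) ler_pM2r// ltr_pM2r.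
split=> [<- i|h].
  have := Num.Theory.floor_itv (2 ^+ l * x 0 i); rewrite ffunE.
  by rewrite -(ler_pM2r (scale_gt0 l)) -[X in _ && X -> _](ltr_pM2r (scale_gt0 l)) scaleK.
by apply/ffunP => i; rewrite ffunE; apply/eqP; rewrite -e.
Qed.

Lemma cell_eq_dist m l (x y : 'rV[R]_m) i : cell l x = cell l y ->
  `|x 0 i - y 0 i| <= scale l.
Proof.
move=> xy; have /cellP/(_ i) := xy; have /cellP/(_ i) := erefl (cell l y).
by rewrite intrD mulrDl mul1r; move: ((_ : int)%:~R * _) => a; rewrite ler_norml; lra.
Qed.

Lemma cell_dist m l (x y : 'rV[R]_m) i (a : nat) : `|x 0 i - y 0 i| < a%:R * scale l ->
  (cell l y i - a%:Z <= cell l x i)%R && (cell l x i <= cell l y i + a%:Z).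
Proof.
move=> xy.
have /cellP/(_ i) := erefl (cell l y); have /cellP/(_ i) := erefl (cell l x).
move: xy; rewrite -(scaleK l (x 0 i)) -(scaleK l (y 0 i)).
rewrite -mulrBl normrM (gtr0_norm (scale_gt0 l)) ltr_pM2r// ltr_norml.
rewrite !ler_pM2r// !ltr_pM2r// !intrD.
move: (2 ^+ l * x 0 i) (2 ^+ l * y 0 i) (cell l x i) (cell l y i) => u v p q.
move=> /andP[h1 h2] /andP[h3 h4] /andP[h5 h6].
apply/andP; split; rewrite -ltzD1 -(ltr_int R) !intrD ?intrN -?pmulrn; lra.
Qed.

(* The [2 a + 1] neighbours of [z] in each coordinate, [e] being offset by [a]. *)
Definition shift m a (z : lattice m) (e : {ffun 'I_m -> 'I_(a + a).+1}) : lattice m :=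
  [ffun i => z i + (e i)%:Z - a%:Z].

Lemma cell_shift m l (x y : 'rV[R]_m) (a : nat) :
  (forall i, `|x 0 i - y 0 i| < a%:R * scale l) ->
  exists e, cell l x = @shift m a (cell l y) e.
Proof.
move=> xy.
have h i : (absz (cell l x i - cell l y i + a%:Z)%R < (a + a).+1)%N.
  by have := cell_dist (xy i); lia.
exists [ffun i => Ordinal (h i)]; apply/ffunP => i; rewrite [RHS]ffunE.
rewrite (_ : nat_of_ord ([ffun i => Ordinal (h i)] i) =
  absz (cell l x i - cell l y i + a%:Z)%R); last by rewrite ffunE.
have := cell_dist (xy i); move: (cell l x i) (cell l y i) => p q; lia.
Qed.

End dyadic_cells.
#[global] Hint Extern 0 (is_true (0 < scale _)) => solve [exact: scale_gt0] : core.
#[global] Hint Extern 0 (is_true (0 <= scale _)) => solve [exact: scale_ge0] : core.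

(** * The tree of dyadic cubes *)

Section dyadic_nodes.
Variable n : nat.

Definition node := (nat * lattice n)%type.

Definition child (e : {ffun 'I_n -> bool}) (w : node) : node :=
  (w.1.+1, [ffun i => 2 * w.2 i + (e i : nat)%:Z]).

Definition parent (w : node) : node :=
  (w.1.-1, [ffun i => (w.2 i %/ 2)%Z]).

Lemma parent_child e w : parent (child e w) = w.
Proof.
case: w => l z; congr (_, _); apply/ffunP => i; rewrite !ffunE /=.
by case: (e i); lia.
Qed.

Lemma child_inj w : injective (child^~ w).
Proof.
move=> e e' [/ffunP h]; apply/ffunP => i; have := h i; rewrite !ffunE.
by case: (e i); case: (e' i); lia.
Qed.

Lemma descendants_level j w v : v \in descendants child j w -> v.1 = (w.1 + j)%N.
Proof.
elim: j w => [|j ih] w /=; first by rewrite mem_seq1 addn0 => /eqP ->.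
by move=> /flatten_mapP[e _ /ih ->]; rewrite addSnnS.
Qed.

Lemma size_descendants j w : size (descendants child j w) = ((2 ^ n) ^ j)%N.
Proof.
elim: j w => [|j ih] w //=; rewrite size_flatten /shape -map_comp.
rewrite (eq_map (g := fun=> ((2 ^ n) ^ j)%N)); last by move=> e /=; rewrite ih.
by rewrite sumnE big_map big_const_seq count_predT iter_addn_0 -cardE card_ffun
  card_bool card_ord mulnC expnS.
Qed.

Definition below (v w : node) := (w.1 <= v.1)%N && (iter (v.1 - w.1) parent v == w).

Lemma below_refl v : below v v.
Proof. by rewrite /below leqnn subnn/=. Qed.

Lemma below_child e v w : below v w -> below (child e v) w.
Proof.
move=> /andP[wv /eqP vw]; rewrite /below /= (leqW wv)/= subSn//.
by rewrite iterSr parent_child vw eqxx.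
Qed.

Lemma below_childP e v w : below (child e v) w -> w = child e v \/ below v w.
Proof.
rewrite /below/= leq_eqVlt => /andP[/predU1P[->|]].
  by rewrite subnn/= => /eqP ->; left.
by rewrite ltnS => wv; rewrite subSn// iterSr parent_child => vw; right; rewrite wv.
Qed.

Lemma child_below_parent e v w : below v (child e w) -> below v w.
Proof.
move=> /andP[/= wv /eqP vw]; rewrite /below (ltnW wv)/=.
by rewrite -(subnSK wv) iterS vw parent_child.
Qed.

Lemma child_below_inj e e' v w : below v (child e w) -> below v (child e' w) -> e = e'.
Proof.
move=> /andP[/= _ /eqP h] /andP[/= _ /eqP h'].
by apply: (@child_inj w); rewrite -h -h'.
Qed.

End dyadic_nodes.

Section node_of_point.
Context {R : realType} {n : nat}.

Definition node_of (l : nat) (x : 'rV[R]_n) : node n := (l, cell l x).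

Lemma node_ofS l x : exists e, node_of l.+1 x = child e (node_of l x).
Proof.
have h i : 2 * cell l x i <= cell l.+1 x i <= 2 * cell l x i + 1.
  have /cellP/(_ i) := erefl (cell l x); have /cellP/(_ i) := erefl (cell l.+1 x).
  rewrite (scaleS l) !mulrA -(scaleK l.+1 (x 0 i)) !ler_pM2r// !ltr_pM2r// !intrD.
  move: (2 ^+ l.+1 * x 0 i) (cell l.+1 x i) (cell l x i) => u p q.
  move=> /andP[h3 h4] /andP[h5 h6].
  apply/andP; split; rewrite -ltzD1 -(ltr_int R) !intrD ?intrM; lra.
exists [ffun i => cell l.+1 x i == 2 * cell l x i + 1].
congr (_, _); apply/ffunP => i; rewrite [RHS]ffunE.
rewrite (_ : [ffun i => _] i = (cell l.+1 x i == 2 * cell l x i + 1)); last by rewrite ffunE.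
by have := h i; case: eqP => /=; lia.
Qed.

Lemma mem_descendants j l x :
  node_of (l + j) x \in descendants (@child n) j (node_of l x).
Proof.
elim: j l => [|j ih] l; first by rewrite addn0 mem_seq1.
apply/flatten_mapP; have [e he] := node_ofS l x.
by exists e; rewrite ?mem_enum// -he addnS -addSn.
Qed.

End node_of_point.

Section node_weight.
Context {R : realType} (n : nat) (b : R).

Definition weight (w : node n) : R := scale w.1 `^ b.

Lemma weight_ge0 w : 0 <= weight w. Proof. exact: powR_ge0. Qed.

(** Each of the 2^n children weighs 2^(-b) times the parent, hence the restriction on [b]. *)
Lemma weight_le_children w : b <= n%:R -> weight w <= \sum_e weight (child e w).
Proof.
move=> bn; rewrite /weight /= sumr_const card_ffun card_bool card_ord.
rewrite scaleS powRM// -[leRHS]mulr_natl ler_wpM2r ?powR_ge0//.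
by rewrite natrX -powR_mulrn// ler_powR// ler1n.
Qed.

(** Induction on the depth, over the cubes that belong to [s] or lie in no member of [s]: a cube
    strictly inside a member may have positive content without any member below it. *)
Lemma net_content_below_le dY (Y : measurableType dY) (D : node n -> set Y) y
    (s : seq (node n)) d (z : lattice n) :
  (forall w, D w y -> exists2 v, v \in s & below w v) ->
  net_content (@child n) weight d D (0%N, z) y <= \sum_(v <- s) weight v.
Proof.
move=> Ds.
suff h w : w \in s \/ ~ (exists2 v, v \in s & below w v) ->
    net_content (@child n) weight d D w y <= \sum_(v <- s | below v w) weight v.
  apply: le_trans (h _ _) _.
    have [h0|h0] := pselect (exists2 v, v \in s & below (0%N, z) v); last by right.
    left; have [v vs] := h0; by rewrite /below => /andP[_ /eqP/= ->].
  rewrite big_mkcond/=; apply: ler_sum => v _; case: ifP => // _; exact: weight_ge0.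
elim: d w => [|d ih] w ws.
  have := ws; have [win _|wout [//|nw]] := boolP (w \in s).
    apply: le_trans (net_content_le_wt (@child n) weight_ge0 0 D w y) _.
    rewrite (big_rem w)//= below_refl lerDl sumr_ge0// => v _; exact: weight_ge0.
  rewrite /= indicE memNset ?mulr0; last by move=> /Ds.
  by rewrite sumr_ge0// => v _; exact: weight_ge0.
have := ws; have [win _|wout [//|nw]] := boolP (w \in s).
  apply: le_trans (net_content_le_wt (@child n) weight_ge0 _ D w y) _.
  rewrite (big_rem w)//= below_refl lerDl sumr_ge0// => v _; exact: weight_ge0.
apply: (@le_trans _ _ (\sum_e net_content (@child n) weight d D (child e w) y)).
  by rewrite /= ge_min lexx orbT.
apply: (@le_trans _ _ (\sum_e \sum_(v <- s | below v (child e w)) weight v)).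
  apply: ler_sum => e _; apply: ih.
  have [cs|cs] := boolP (child e w \in s); [by left|right] => -[v vs].
  by move=> /below_childP[vE|vw]; [rewrite -vE vs in cs|apply: nw; exists v].
under eq_bigr do rewrite big_mkcond.
rewrite exchange_big/= [leRHS]big_mkcond/=; apply: ler_sum => v _.
(* Distinct children have no common descendant, so each [v] is counted for at most one child. *)
have [[e0 ve0]|nv] := pselect (exists e0, below v (child e0 w)).
  rewrite (bigD1 e0)//= ve0 (child_below_parent ve0) big1 ?addr0// => e ee0.
  by case: ifP => // /(child_below_inj ve0) h; rewrite h eqxx in ee0.
rewrite big1 => [|e _]; first by case: ifP => // _; exact: weight_ge0.
by case: ifP => // h; case: nv; exists e.
Qed.

End node_weight.

Lemma rV_ballP (R : realType) m (x y : 'rV[R]_m) (r : R) :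
  ball x r y <-> 0 < r /\ forall j, `|x 0 j - y 0 j| < r.
Proof.
split=> [[r0 xy]|[r0 xy]]; split=> // j; first by have := xy 0 j; rewrite -ball_normE.
by move=> i; rewrite ord1 -ball_normE /=; exact: xy.
Qed.

(** * Measurable covers of the fibres *)

Section null_sets.
Context {R : realType} (n : nat) (b : R).
Hypothesis b_gt0 : 0 < b.

(** At the dyadic scale between [q] and [2 * q] the set lies in an open cube of radius two cells
    about one of its points, which meets at most 5^n cells. The bound [q] stays positive even when
    the diameter is 0. *)
Lemma small_set_nodes (F : set 'rV[R]_n) (q : R) : 0 < q -> q <= 1 ->
  (diam (@edist R n) F <= q%:E)%E ->
  exists O (s : seq (node n)), [/\ open O, F `<=` O,
    forall x, O x -> exists l, node_of l x \in s &
    \sum_(v <- s) weight b v <= 5 ^+ n * (2 * q) `^ b].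
Proof.
move=> q0 q1 Fq; have [F0|/set0P[y Fy]] := eqVneq F set0.
  exists set0, [::]; split => //; first by rewrite F0.
  by rewrite big_nil mulr_ge0 ?exprn_ge0// powR_ge0.
have [l /andP[lq ql]] := scale_between q0 q1.
exists (ball y (2 * scale l)),
  [seq (l, shift (cell l y) e) | e <- enum {ffun 'I_n -> 'I_(2 + 2).+1}].
split.
- exact: ball_open.
- move=> x Fx; apply/rV_ballP; split=> [|j]; first by rewrite mulr_gt0.
  apply: le_lt_trans (edist_coord y x j) _.
  apply: le_lt_trans (le_dist_diam Fq Fy Fx) _.
  by have := scale_gt0 (R := R) l; lra.
- move=> x yx; exists l; have [|e he] := @cell_shift R n l x y 2.
    by move=> i; rewrite distrC; have /rV_ballP[_] := yx; exact.
  by apply/mapP; exists e; rewrite ?mem_enum// /node_of he.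
- rewrite big_map big_enum/= /weight /= sumr_const card_ffun !card_ord -[leLHS]mulr_natl.
  rewrite natrX ler_wpM2l ?exprn_ge0//; apply: ge0_ler_powR; rewrite ?nnegrE//.
  + exact: ltW.
  + by rewrite mulr_ge0// ltW.
  + by have := scaleS (R := R) l; lra.
Qed.

(** Compactness leaves finitely many cubes, and these still cover an open neighbourhood of [A]; that
    neighbourhood later absorbs small changes of the parameter. *)
Lemma null_compact_nodes (A : set 'rV[R]_n) (e : R) : compact A ->
  hausdorff_measure (@edist R n) b A = 0%E -> 0 < e ->
  exists O (s : seq (node n)), [/\ open O, A `<=` O,
    forall x, O x -> exists l, node_of l x \in s &
    \sum_(v <- s) weight b v <= e].
Proof.
move=> cA A0 e0; pose C : R := 5 ^+ n * 2 `^ b.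
have C0 : 0 < C by rewrite mulr_gt0 ?exprn_gt0 ?powR_gt0.
(* One [e'] pays for the Hausdorff cover, a second one for enlarging its sets; [C] is the cost
   factor of passing to cubes. *)
pose e' : R := Num.min 1 (e / (2 * C)).
have e'0 : 0 < e' by rewrite lt_min ltr01 divr_gt0// mulr_gt0.
have e'1 : e' <= 1 by rewrite ge_min lexx.
have e'C : C * (e' + e') <= e.
  have : e' <= e / (2 * C) by rewrite ge_min lexx orbT.
  by rewrite ler_pdivlMr ?mulr_gt0//; lra.
have half0 : 0 < 2^-1 :> R by rewrite invr_gt0.
have := premeasure_eq0 half0 A0; move=> pre0.
have [|F [AF dF sF]] := @premeasure_cover _ _ (@edist R n) b 2^-1 A e'.
  by rewrite pre0 lte_fin.
pose u i : R := e' / (2 ^ i.+1)%:R.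
have u0 i : 0 < u i by rewrite divr_gt0// ltr0n expn_gt0.
have u1 i : u i <= 1.
  by rewrite ler_pdivrMr ?ltr0n ?expn_gt0// mul1r (le_trans e'1)// ler1n expn_gt0.
pose dd i := fine (diam (@edist R n) (F i)).
have ddE i : diam (@edist R n) (F i) = (dd i)%:E.
  rewrite fineK// ge0_fin_numE ?diam_ge0//.
  exact: le_lt_trans (dF i) (ltry _).
have dd0 i : 0 <= dd i by rewrite fine_ge0// diam_ge0.
have ddpow i : ((dd i `^ b)%:E <= diam_pow (@edist R n) b (F i))%E.
  rewrite /diam_pow; case: asboolP => [F0|_]; last by rewrite ddE.
  by rewrite /dd F0 diam0 powR0// gt_eqF.
(* Raising the diameter to at least the 1/b-th power of [u i] makes it positive and adds at most
   [u i] to the sum of b-th powers. *)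
pose q i := Num.max (dd i) (u i `^ b^-1).
have q0 i : 0 < q i by rewrite lt_max powR_gt0 ?orbT.
have q1 i : q i <= 1.
  rewrite ge_max; apply/andP; split.
    by have := dF i; rewrite ddE lee_fin; lra.
  rewrite (_ : 1 = 1 `^ b^-1); last by rewrite powR1.
  by apply: ge0_ler_powR; rewrite ?nnegrE ?invr_ge0//; exact: ltW.
have qb i : ((q i `^ b)%:E <= diam_pow (@edist R n) b (F i) + (u i)%:E)%E.
  rewrite /q; case: (leP (dd i) (u i `^ b^-1)) => _.
    rewrite -powRrM mulVf ?gt_eqF// powRr1 ?(ltW (u0 i))//.
    by rewrite leeDr// diam_pow_ge0.
  by apply: le_trans (ddpow i) _; rewrite leeDl// lee_fin ltW.
have /choice[Os OsP] : forall i, exists Os : set 'rV[R]_n * seq (node n),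
    [/\ open Os.1, F i `<=` Os.1,
    forall x, Os.1 x -> exists l, node_of l x \in Os.2 &
    \sum_(v <- Os.2) weight b v <= 5 ^+ n * (2 * q i) `^ b].
  move=> i; have [|O [s OsP]] := small_set_nodes (F := F i) (q0 i) (q1 i).
    by rewrite ddE lee_fin le_max lexx.
  by exists (O, s).
have := cA; rewrite compact_cover => /(_ nat setT (fun i => (Os i).1)) [].
- by move=> i _; have [] := OsP i.
- move=> x Ax; have [i _ Fx] := AF x Ax; exists i => //.
  by have [_ h _ _] := OsP i; exact: h.
move=> D' _ AD'; pose M := (\max_(i <- finmap.enum_fset D') i)%N.+1.
exists (\bigcup_(i in [set i | (i < M)%N]) (Os i).1).
exists (flatten [seq (Os i).2 | i <- iota 0 M]); split.
- by apply: bigcup_open => i _; have [] := OsP i.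
- move=> x /AD'[i /= iD' Ox]; exists i => //=.
  by rewrite ltnS; apply: (@leq_bigmax_seq _ (finmap.enum_fset D') xpredT id i).
- move=> x [i iM Ox]; have [_ _ h _] := OsP i; have [l hl] := h x Ox.
  exists l; apply/flattenP; exists (Os i).2 => //.
  by apply/mapP; exists i; rewrite ?mem_iota//; exact: iM.
rewrite big_flatten big_map.
apply: (@le_trans _ _ (\sum_(i <- iota 0 M) C * q i `^ b)).
  by apply: ler_sum => i _; have [_ _ _] := OsP i; rewrite powRM ?mulrA// ltW.
rewrite -mulr_sumr; apply: le_trans e'C; rewrite ler_wpM2l ?(ltW C0)//.
rewrite -lee_fin -sumEFin.
rewrite (_ : iota 0 M = index_iota 0 M); last by rewrite /index_iota subn0.
apply: (@le_trans _ _ (\sum_(0 <= i < M) (diam_pow (@edist R n) b (F i) + (u i)%:E))%E).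
  exact: lee_sum.
apply: (@le_trans _ _ (\sum_(i <oo) (diam_pow (@edist R n) b (F i) + (u i)%:E))%E).
  by apply: nneseries_lim_ge => i _ _; rewrite adde_ge0 ?diam_pow_ge0// lee_fin ltW.
apply: le_trans (epsilon_trick xpredT (fun i => diam_pow_ge0 _ b (F i)) (ltW e'0)) _.
by rewrite EFinD leeD2r// ltW.
Qed.

End null_sets.

Section compact_capacity.
Context {R : realType} (k n : nat) (alpha b : R) (T1 : set 'rV[R]_k).
Hypothesis b_gt0 : 0 < b.
Local Notation mu0 := (hausdorff_outer (@edist R k) alpha T1).
Local Notation mu := (hausdorff_cara (@edist R k) alpha T1).
Hypothesis mu_fin : (mu setT < +oo)%E.

Lemma measurable_coord_lt i (a : R) :
  mu0.-cara.-measurable [set x : 'rV[R]_k | x 0 i < a].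
Proof.
apply: caratheodory_hausdorff_sublevel => x y; exact: edist_coord.
Qed.

Lemma measurable_coord_gt i (a : R) :
  mu0.-cara.-measurable [set x : 'rV[R]_k | a < x 0 i].
Proof.
rewrite (_ : [set x | _] = [set x : 'rV[R]_k | - x 0 i < - a]).
  apply: (@caratheodory_hausdorff_sublevel _ _ _ _ _ (fun x : 'rV[R]_k => - x 0 i)) => x y.
  by rewrite -opprD normrN; exact: edist_coord.
by apply/seteqP; split=> x /=; rewrite ltrN2.
Qed.

Lemma measurable_cube (x : 'rV[R]_k) (r : R) : 0 < r -> mu0.-cara.-measurable (ball x r).
Proof.
move=> r0; rewrite (_ : ball x r = \bigcap_(i in [set: 'I_k])
   ([set y : 'rV[R]_k | y 0 i < x 0 i + r] `&` [set y : 'rV[R]_k | x 0 i - r < y 0 i])).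
  apply: fin_bigcap_measurable; first exact: finite_finset.
  by move=> i _; apply: measurableI; [exact: measurable_coord_lt|exact: measurable_coord_gt].
apply/seteqP; split=> [y /rV_ballP[_ xy] i _|y xy] /=.
  by have := xy i; rewrite ltr_distl => /andP[h1 h2]; split; lra.
apply/rV_ballP; split=> // j.
by rewrite ltr_distl; have [/= h1 h2] := xy j Logic.I; lra.
Qed.

(** Near each [t] and for large [m], one light finite family of cubes covers all the fibres of
    [K m]. Finitely many such neighbourhoods cover the base, and cutting them into disjoint
    measurable pieces gives a measurable family of covers. *)
Lemma net_capacity_compact (Kb : set 'rV[R]_k) (Kf : set 'rV[R]_n)
    (K : nat -> set ('rV[R]_k * 'rV[R]_n)) (z : lattice n) (e : R) :
  compact Kb -> compact Kf -> (forall m, closed (K m)) ->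
  (forall m, K m `<=` Kb `*` Kf) -> (forall m, K m.+1 `<=` K m) ->
  (forall t, hausdorff_measure (@edist R n) b [set x | forall m, K m (t, x)] = 0%E) ->
  0 < e ->
  exists m, net_capacity (@child n) (weight b) mu (0%N, z) (@node_of R n) (K m) <= e.
Proof.
move=> cKb cKf cK KK decK K0 e0.
have decK' m m' : (m <= m')%N -> K m' `<=` K m.
  by move=> /subnK <-; elim: (m' - m)%N => // i ih; exact: subset_trans (decK _) ih.
pose e' := e / (fine (mu setT) + 1).
have mT0 : 0 <= fine (mu setT) by rewrite fine_ge0// outer_measure_ge0.
have e'0 : 0 < e' by rewrite divr_gt0// ltr_wpDl.
have near_t t : exists r (s : seq (node n)) (m : nat), [/\ 0 < r,
    \sum_(v <- s) weight b v <= e' &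
    forall t' x, ball t r t' -> K m (t', x) -> exists l, node_of l x \in s].
  have [|O [s [oO AO Os se]]] := @null_compact_nodes R n b b_gt0
      [set x | forall m, K m (t, x)] e' _ (K0 t) e'0.
    apply: (subclosed_compact _ cKf).
      rewrite (_ : [set x | _] = \bigcap_(m in setT) ((fun x => (t, x)) @^-1` K m)).
        apply: closed_bigI => m _; apply: closed_comp; last exact: cK.
        move=> x _ W [[U V] [/= Ut Vx] UV]; apply: filterS Vx => x' Vx'.
        by apply: (UV (t, x')); split => //=; exact: nbhs_singleton.
      by apply/seteqP; split=> x h m; [move=> _; exact: h|exact: (h m Logic.I)].
    by move=> x /(_ 0%N)/KK[].
  (* If [x] is outside [O] then [(t, x)] is outside some closed [K m], as are all nearby points;
     compactness of [Kf] makes one [m] and one neighbourhood of [t] serve all [x]. *)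
  have /compact_near_coveringP := cKf.
  move=> /(_ _ (filter_prod (nbhs t) \oo) (fun p x => K p.2 (p.1, x) -> O x) _) ncov.
  have [x Kfx|[U V] [/= Ut [m _ Vm]] UV] := ncov.
    have [Ox|Ox] := pselect (O x).
      exists (O, setT) => /=; first by split; [exact: open_nbhs_nbhs|exact: filterT].
      by move=> [x' p] [].
    have [m Km] : exists m, ~ K m (t, x).
      by apply: contrapT => /forallNP h; apply: Ox; apply: AO => m; have /contrapT := h m.
    have : nbhs (t, x) (~` K m).
      by apply: open_nbhs_nbhs; split => //; exact: closed_openC.
    move=> [[U W] [/= Ut Wx] UW].
    exists (W, (U `*` [set i | (m <= i)%N])) => /=.
      split => //; exists (U, [set i | (m <= i)%N]) => //=; split => //.
      by exists m.
    move=> [x' [t' i]] [/= Wx' [Ut' mi]] Ki; exfalso.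
    by apply: (UW (t', x')) => //; exact: decK' Ki.
  have /nbhs_ballP[r /= r0 rU] := Ut.
  exists r, s, m; split => // t' x tt' Kx; apply: Os.
  have [_ Kfx] := KK _ _ Kx.
  by apply: (UV (t', m)) => //; split; [exact: rU|apply: Vm => /=].
have /choice[r /choice[s /choice[M rsM]]] := near_t.
have := cKb; rewrite compact_cover => /(_ _ setT (fun t => ball t (r t))) [].
- by move=> t _; exact: ball_open.
- by move=> t _; exists t => //; apply: ballxx; have [] := rsM t.
move=> D' _ covD'.
pose ts := finmap.enum_fset D'.
pose U i := ball (nth 0 ts i) (r (nth 0 ts i)).
pose S i := s (nth 0 ts i).
(* Only the first ball containing [t] counts, so that exactly one family is used over each [t]. *)
pose piece i := U i `\` \bigcup_(j in [set j | (j < i)%N]) U j.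
have mpiece i : mu0.-cara.-measurable (piece i).
  have mU j : mu0.-cara.-measurable (U j).
    by apply: measurable_cube; have [] := rsM (nth 0 ts j).
  by apply: measurableD => //; exact: bigcup_measurable.
have piece_inj i j t : piece i t -> piece j t -> i = j.
  move=> [Ui nUi] [Uj nUj]; have [ij|ji|//] := ltngtP i j.
    by case: nUj; exists i.
  by case: nUi; exists j.
pose D w : set 'rV[R]_k := \bigcup_(i in [set i | exists2 v, v \in S i & below w v]) piece i.
pose m := (\max_(t <- ts) M t)%N.
exists m.
have aD : @admissible _ (caratheodory_type mu0) _ _ (@child n) D.
  split=> [w|c w t [i [v vS wv] it]]; first by apply: bigcup_measurable => i _; exact: mpiece.
  by exists i => //; exists v => //; exact: below_child.
have pt i t : piece i t -> forall w, D w t -> exists2 v, v \in S i & below w v.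
  by move=> it w [j [v vS wv] jt]; rewrite (piece_inj i j t it jt); exists v.
have contD d t : @net_content _ (caratheodory_type mu0) _ _ _ (@child n) (weight b) d D (0%N, z) t <= e'.
  have [[i it]|nt] := pselect (exists i, piece i t).
    apply: le_trans (@net_content_below_le R n b _ (caratheodory_type mu0) D t (S i) d z (pt i t it)) _.
    by have [] := rsM (nth 0 ts i).
  have := @net_content_below_le R n b _ (caratheodory_type mu0) D t [::] d z.
  rewrite big_nil => h; apply: le_trans (h _) (ltW e'0).
  by move=> w [j _ jt]; case: nt; exists j.
apply: le_trans (net_capacity_le (@weight_ge0 R n b) (0%N, z) mu_fin aD _) _.
  move=> [t x] Ktx /=; have [Kbt _] := KK _ _ Ktx.
  have [t0 /= t0D' t0t] := covD' t Kbt.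
  have ex : exists i, (i < size ts)%N && `[< U i t >].
    exists (seq.index t0 ts); rewrite index_mem t0D'/=; apply/asboolP.
    by rewrite /U nth_index.
  pose i := ex_minn ex; have : (i < size ts)%N /\ piece i t.
    rewrite /i; case: ex_minnP => i' /andP[i's /asboolP Ui'] mini; split=> //; split=> //.
    move=> [j /= ji Uj]; have := mini j; rewrite (ltn_trans ji i's)/=.
    by move=> /(_ (asboolT Uj)); rewrite leqNgt ji.
  move=> [its it]; have [_ _] := rsM (nth 0 ts i).
  move=> /(_ t x it.1) [|l lx].
    apply: decK' Ktx; apply: (@leq_bigmax_seq _ ts xpredT M) => //.
    exact: mem_nth.
  by exists l, i => //; exists (node_of l x) => //; exact: below_refl.
apply: net_cost_le => d.
rewrite -lee_fin -net_integralE//; [|exact: weight_ge0|exact: aD.1].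
apply: (@le_trans _ _ (\int[mu]_y (cst e'%:E y))%E).
  apply: ge0_le_integral; [exact: measurableT|..].
  - by move=> y _; rewrite lee_fin net_content_ge0//; exact: weight_ge0.
  - apply/measurable_EFinP; apply: measurable_net_content; exact: aD.1.
  - exact: measurable_cst.
  - by move=> y _; rewrite lee_fin; exact: contD.
rewrite integral_cst// -(@fineK _ (mu setT)); last first.
  by rewrite ge0_fin_numE// outer_measure_ge0.
by rewrite -EFinM lee_fin /e' mulrAC ler_pdivrMr ?ltr_wpDl// ler_wpM2l ?(ltW e0)// lerDl.
Qed.

End compact_capacity.

Lemma expr_lt_exists (R : realType) (q e : R) : 0 <= q -> q < 1 -> 0 < e ->
  exists m, q ^+ m < e.
Proof.
move=> q0 q1 e0.
have : geometric 1 q @ \oo --> 0 by apply: cvg_geometric; rewrite ger0_norm.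
move=> /cvgr0Pnorm_lt/(_ e e0)[m _ /(_ m (leqnn m))] /=.
by rewrite mul1r ger0_norm ?exprn_ge0//; exists m.
Qed.

Lemma geometric_tail_le (R : realType) (q C : R) N : 0 <= q -> q < 1 -> 0 <= C ->
  (\sum_(N <= l <oo) (C * q ^+ l)%:E <= (C * q ^+ N / (1 - q))%:E)%E.
Proof.
move=> q0 q1 C0; apply: lime_le.
  by apply: is_cvg_nneseries => l _ _; rewrite lee_fin mulr_ge0// exprn_ge0.
apply: nearW => M; rewrite sumEFin lee_fin.
rewrite ler_pdivlMr ?subr_gt0//.
have [MN|NM] := leqP M N.
  by rewrite big_geq// mul0r mulr_ge0// exprn_ge0.
have -> : (\sum_(N <= l < M) C * q ^+ l) * (1 - q) = C * (q ^+ N - q ^+ M).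
  rewrite -mulr_sumr -mulrA; congr (_ * _).
  rewrite mulr_suml (eq_bigr (fun l => - (q ^+ l.+1 - q ^+ l))).
    by rewrite sumrN telescope_sumr ?opprB// ltnW.
  by move=> l _; rewrite exprS; ring.
by rewrite ler_wpM2l// lerBlDr lerDl exprn_ge0.
Qed.

Lemma compact_box (R : realType) m (a b : 'I_m -> R) :
  compact [set x : 'rV[R]_m | forall i, a i <= x 0 i <= b i].
Proof.
have := @rV_compact R m (fun i => `[a i, b i]%classic) (fun i => @segment_compact R (a i) (b i)).
by congr compact; apply/seteqP; split=> x /= h i; have := h i; rewrite ?in_itv/=.
Qed.

Lemma compact_closed_rV (R : realType) m (A : set 'rV[R]_m) : compact A -> closed A.
Proof. by apply: compact_closed; exact: norm_hausdorff. Qed.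

Lemma closed_setM (U V : topologicalType) (A : set U) (B : set V) :
  closed A -> closed B -> closed (A `*` B).
Proof.
move=> cA cB.
rewrite (_ : A `*` B = (fst @^-1` A) `&` (snd @^-1` B)); last by apply/seteqP; split.
by apply: closedI; (apply: closed_comp => // x _); [exact: cvg_fst|exact: cvg_snd].
Qed.

(** * Thin measurable covers of Borel sets *)

Section thin_covers.
Context {R : realType} (k n : nat) (alpha b : R) (T1 : set 'rV[R]_k).
Local Notation mu0 := (hausdorff_outer (@edist R k) alpha T1).
Local Notation mu := (hausdorff_cara (@edist R k) alpha T1).
Hypothesis b_gt0 : 0 < b.
Hypothesis mu_fin : (mu setT < +oo)%E.

Lemma net_capacity_borel (Kb : set 'rV[R]_k) (Kf : set 'rV[R]_n)
    (B : set ('rV[R]_k * 'rV[R]_n)) (z : lattice n) :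
  b <= n%:R -> compact Kb -> compact Kf -> borel B -> B `<=` Kb `*` Kf ->
  (forall t, hausdorff_measure (@edist R n) b [set x | B (t, x)] = 0%E) ->
  net_capacity (@child n) (weight b) mu (0%N, z) (@node_of R n) B <= 0.
Proof.
move=> bn cKb cKf bB BK B0.
apply/ler_addgt0Pr => e e0; rewrite add0r.
have cKK : closed (Kb `*` Kf) by apply: closed_setM; exact: compact_closed_rV.
apply: (@suslin_capacity_le ('rV[R]_k * 'rV[R]_n)%type R
  (net_capacity (@child n) (weight b) mu (0%N, z) (@node_of R n)) e B (Kb `*` Kf)) => //.
- move=> U V UV; apply: le_net_capacity => //; exact: weight_ge0.
- move=> U c ndU Uc.
  exact: (@net_capacity_bigcup_le _ (caratheodory_type mu0) _ _ _ (@child n) (weight b)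
    (@weight_ge0 R n b) (fun w => @weight_le_children R n b w bn) mu (0%N, z) mu_fin _
    (@node_of R n) (@node_ofS R n) U c ndU Uc).
- move=> K cK KK decK KB; apply: (net_capacity_compact b_gt0 mu_fin z cKb cKf) => //.
  move=> t; apply/eqP; rewrite eq_le hausdorff_measure_ge0 andbT -(B0 t).
  by apply: le_hausdorff_measure => x Kx; apply: KB => m _; exact: Kx.
- apply: borel_suslin bB => U oU; exact: (@open_Fsigma R ('rV[R]_k * 'rV[R]_n)%type).
Qed.

Lemma parent_node_of l (x : 'rV[R]_n) : parent (node_of l.+1 x) = node_of l x.
Proof. by have [e ->] := node_ofS l x; rewrite parent_child. Qed.

(** [A v] is the set of parameters for which [v] is a maximal selected cube. All cubes of level [l]
    have the same weight, so the bound on the integrated weight becomes a bound on measures at each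
    level. The case [b > n] does occur, as b = beta + tau with beta possibly equal to n. *)
Lemma thin_cover (Kb : set 'rV[R]_k) (Kf : set 'rV[R]_n)
    (B : set ('rV[R]_k * 'rV[R]_n)) (z : lattice n) (e : R) :
  compact Kb -> compact Kf -> borel B -> B `<=` Kb `*` Kf ->
  (forall t, hausdorff_measure (@edist R n) b [set x | B (t, x)] = 0%E) ->
  0 < e ->
  exists A : node n -> set 'rV[R]_k, [/\ forall v, mu0.-cara.-measurable (A v),
    forall t x, B (t, x) -> exists l, A (node_of l x) t &
    forall l, (\sum_(v <- descendants (@child n) l (0%N, z)) mu (A v) <=
      (e / scale l `^ b)%:E)%E].
Proof.
move=> cKb cKf bB BK B0 e0.
have mfin : mu setT \is a fin_num by rewrite ge0_fin_numE// outer_measure_ge0.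
have m0 : 0 <= fine (mu setT) by rewrite fine_ge0// outer_measure_ge0.
have [bn|nb] := leP b n%:R.
  have cap0 := net_capacity_borel z bn cKb cKf bB BK B0.
  have wt0 := @weight_ge0 R n b.
  have [D [aD DB] De] := net_capacity_adherent (@child n) wt0 (0%N, z) mu_fin (@node_of R n) B e0.
  have mD := aD.1.
  exists (fun v => first_selected (@child n) (weight b) (@parent n) D v.1 v); split.
  - by move=> v; exact: measurable_first_selected.
  - move=> t x Btx.
    have ex : exists l, `[< selected (@child n) (weight b) D (node_of l x) t >].
      by have [l Dl] := DB (t, x) Btx; exists l; apply/asboolP; exact: sub_selected.
    exists (ex_minn ex); case: ex_minnP => l /asboolP sl minl.
    split => //= above.
    have [j jl sj] : exists2 j, (j < l)%N & selected (@child n) (weight b) D (node_of j x) t.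
      elim: l {sl minl} above => [//|l ih] /=; rewrite parent_node_of => -[/ih[j jl sj]|sl].
        by exists j => //; exact: ltnW.
      by exists l.
    by have := minl j (asboolT sj); rewrite leqNgt jl.
  - move=> l; have wl0 : 0 < scale l `^ b :> R by rewrite powR_gt0.
    rewrite EFinM muleC lee_pdivlMl//.
    have := @sum_measure_first_selected _ _ _ _ _ (@child n) (weight b) (@parent n)
      wt0 (fun w => @weight_le_children R n b w bn) (fun c w => parent_child c w)
      mu (0%N, z) mu_fin D l aD.
    rewrite ge0_sume_distrr; last by move=> v _; exact: measure_ge0.
    move=> h; apply: le_trans (le_trans h _); last first.
      by rewrite lee_fin ltW// (lt_le_trans De)// gerDr.
    rewrite big_seq [leRHS]big_seq; apply: lee_sum => v vl.
    by rewrite /weight (descendants_level vl) /= add0n.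
(* For [b > n] all cubes of one fine level already have small total weight. *)
pose q : R := 2^-1 `^ (b - n%:R).
have q1 : q < 1.
  have -> : 1 = 1 `^ (b - n%:R) :> R by rewrite powR1.
  by apply: gt0_ltr_powR; rewrite ?subr_gt0 ?nnegrE//; lra.
have [m qm] : exists m, q ^+ m < e / (fine (mu setT) + 1).
  by apply: expr_lt_exists => //; rewrite ?powR_ge0// divr_gt0// ltr_wpDl.
exists (fun v => if v.1 == m then setT else set0); split.
- by move=> v; case: ifP => _; [exact: measurableT|exact: measurable0].
- by move=> t x _; exists m; rewrite /= eqxx.
- move=> l; rewrite big_seq.
  have [lm|lm] := eqVneq l m; last first.
    rewrite big1 ?lee_fin ?divr_ge0 ?powR_ge0 ?ltW// => v /descendants_level ->.
    by rewrite add0n (negbTE lm); exact: measure0.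
  rewrite (eq_bigr (fun=> (fine (mu setT))%:E)); last first.
    by move=> v /descendants_level ->; rewrite add0n lm eqxx fineK.
  rewrite -big_seq sumEFin lee_fin big_const_seq count_predT size_descendants iter_addr_0.
  rewrite lm ler_pdivlMr ?powR_gt0// -mulr_natr -mulrA.
  have -> : (((2 ^ n) ^ m)%N)%:R * scale m `^ b = q ^+ m.
    rewrite scale_powR (_ : 2^-1 `^ b = q * 2^-1 ^+ n); last first.
      rewrite -powR_mulrn ?invr_ge0// -powRD ?subrK//.
      by apply/implyP => _; rewrite invr_eq0 pnatr_eq0.
    by rewrite !natrX exprMn mulrCA -exprMn exprVn divff ?expr1n ?mulr1// expf_neq0 ?pnatr_eq0.
  move: qm; rewrite ltr_pdivlMr ?ltr_wpDl// => qm; apply: le_trans (ltW qm).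
  by rewrite mulrC ler_wpM2l ?exprn_ge0 ?powR_ge0// lerDl.
Qed.

End thin_covers.

(** * Regular sets and the decomposition *)

Section counting_cells.
Context {R : realType} (k : nat) (alpha : R) (T1 : set 'rV[R]_k).
Local Notation mu0 := (hausdorff_outer (@edist R k) alpha T1).
Local Notation mu := (hausdorff_cara (@edist R k) alpha T1).

Definition cell_set l (y : lattice k) : set 'rV[R]_k := [set t | cell l t = y].

Lemma measurable_cell_set l y : mu0.-cara.-measurable (cell_set l y).
Proof.
rewrite (_ : cell_set l y = \bigcap_(i in [set: 'I_k])
   (~` [set x : 'rV[R]_k | x 0 i < (y i)%:~R * scale l] `&`
    [set x : 'rV[R]_k | x 0 i < (y i + 1)%:~R * scale l])).
  apply: fin_bigcap_measurable; first exact: finite_finset.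
  move=> i _; apply: measurableI; last exact: measurable_coord_lt.
  by apply: measurableC; exact: measurable_coord_lt.
apply/seteqP; split=> [t /cellP ty i _|t ty].
  by have /andP[h1 h2] := ty i; split=> //=; apply/negP; rewrite -leNgt.
by apply/cellP => i; have [/negP/=] := ty i Logic.I; rewrite -leNgt => -> /= ->.
Qed.

Lemma sum_measure_cells l (A : set 'rV[R]_k) (ys : seq (lattice k)) :
  mu0.-cara.-measurable A -> uniq ys ->
  (\sum_(y <- ys) mu (A `&` cell_set l y) <= mu A)%E.
Proof.
move=> mA.
suff h : uniq ys -> (\sum_(y <- ys) mu (A `&` cell_set l y) <=
    mu (A `&` [set t | cell l t \in ys]))%E.
  by move=> /h /le_trans; apply; apply: (le_outer_measure mu0) => t [].
have mys (s : seq (lattice k)) : mu0.-cara.-measurable [set t | cell l t \in s].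
  elim: s => [|y s ih].
    rewrite (_ : [set _ | _] = set0); [exact: measurable0|].
    by apply/seteqP; split=> t //=; rewrite in_nil.
  rewrite (_ : [set _ | _] = cell_set l y `|` [set t | cell l t \in s]).
    by apply: measurableU => //; exact: measurable_cell_set.
  apply/seteqP; split=> t /=; first by rewrite in_cons => /predU1P[ty|ts]; [left|right].
  by rewrite in_cons => -[->|->]; rewrite ?eqxx ?orbT.
elim: ys => [|y ys ih]; first by rewrite big_nil measure_ge0.
rewrite cons_uniq big_cons => /andP[yys /ih {}ih].
apply: (@le_trans _ _ (mu ((A `&` cell_set l y) `|` (A `&` [set t | cell l t \in ys])))).
  rewrite measureU//.
  - by rewrite leeD2l.
  - by apply: measurableI => //; exact: measurable_cell_set.
  - by apply: measurableI => //; exact: mys.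
  - by apply/seteqP; split=> // t [[_ /= ty] [_ /=]]; rewrite ty (negbTE yys).
apply: (le_outer_measure mu0) => t [[At /= ty]|[At /= tys]]; split=> //=.
  by rewrite in_cons ty eqxx.
by rewrite in_cons tys orbT.
Qed.

End counting_cells.

Lemma shift_inj m a (e : {ffun 'I_m -> 'I_(a + a).+1}) : injective (fun z => shift z e).
Proof.
by move=> z z' /ffunP h; apply/ffunP => i; have := h i; rewrite /shift !ffunE => /addIr/addIr.
Qed.

(* The measure of the unit ball bounds the number of disjoint cells that meet
   [T0], as every ball of radius [scale l] centred on [T] lies in [3 ^ k] cells. *)
Lemma regular_cells (R : realType) (k : nat) (alpha c c' : R) (T T0 : set 'rV[R]_k)
    (t0 : 'rV[R]_k) (r : R) (l : nat) : 0 < c ->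
  (forall (t : 'rV[R]_k) (r : R), T t -> 0 < r -> r <= 1 ->
      ((c * r `^ alpha)%:E <=
         hausdorff_measure (@edist R k) alpha (T `&` eball t r))%E /\
      (hausdorff_measure (@edist R k) alpha (T `&` eball t r) <=
         (c' * r `^ alpha)%:E)%E) ->
  T t0 -> T0 `<=` T -> k%:R * (r + r) < 1 ->
  (forall t i, T0 t -> `|t 0 i - t0 0 i| <= r) -> scale l <= r ->
  exists ys : seq (lattice k), [/\ uniq ys,
    forall t, T0 t -> cell l t \in ys,
    forall y, y \in ys -> exists2 t, T0 t & cell l t = y &
    (size ys)%:R <= 3 ^+ k * c' / c * (scale l `^ alpha)^-1].
Proof.
move=> c0 regT Tt0 T0T kr1 T0r lr.
pose T1 := T `&` eball t0 1.
pose mu := hausdorff_cara (@edist R k) alpha T1.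
have r0 : 0 < r := lt_le_trans (scale_gt0 l) lr.
pose a := (Num.truncn (r / scale l)).+1.
pose ys := [seq y <- undup [seq @shift k a (cell l t0) e | e <- enum {ffun 'I_k -> 'I_(a + a).+1}]
  | `[< exists2 t, T0 t & cell l t = y >]].
exists ys; split.
- by rewrite filter_uniq// undup_uniq.
- move=> t T0t; rewrite mem_filter mem_undup; apply/andP; split.
    by apply/asboolP; exists t.
  have [|e ->] := @cell_shift R k l t t0 a.
    move=> i; apply: le_lt_trans (T0r t i T0t) _.
    by rewrite -ltr_pdivrMr// Num.Theory.truncnS_gt.
  by apply: map_f; rewrite mem_enum.
- by move=> y; rewrite mem_filter => /andP[/asboolP].
have uys : uniq ys by rewrite filter_uniq// undup_uniq.
have mT : (mu setT <= c'%:E)%E.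
  have [_] := regT t0 1 Tt0 ltr01 (lexx _); rewrite powR1 mulr1; apply: le_trans.
  by rewrite /mu hausdorff_caraE setTI.
have muy y : y \in ys ->
    ((c * scale l `^ alpha)%:E <= \sum_(e : {ffun 'I_k -> 'I_(1 + 1).+1}) mu (cell_set l (shift y e)))%E.
  rewrite mem_filter => /andP[/asboolP[t T0t ty] _].
  have l1 : scale l <= 1 :> R by exact: scale_le1.
  have [+ _] := regT t (scale l) (T0T _ T0t) (scale_gt0 l) l1.
  move=> /le_trans; apply.
  apply: (@le_trans _ _ (mu (\big[setU/set0]_(e : {ffun 'I_k -> 'I_(1 + 1).+1}) cell_set l (shift y e)))).
    apply: le_hausdorff_measure => x [Tx tx]; split; last first.
      (* In each coordinate [t] is within [r] of [t0] and [x] within [scale l <= r] of [t]; [kr1]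
         then keeps the small ball inside the unit ball carrying the measure. *)
      split => //; rewrite /eball/= (le_lt_trans _ kr1)//.
      apply: edist_le; first by rewrite addr_ge0// ltW.
      move=> i; rewrite distrC.
      apply: le_trans (ler_distD (t 0 i) _ _) _; apply: lerD; last exact: T0r.
      rewrite distrC; apply: le_trans (edist_coord _ _ _) _.
      by apply: ltW; apply: lt_le_trans lr.
    have [|e xe] := @cell_shift R k l x t 1.
      move=> i; rewrite mul1r distrC; exact: le_lt_trans (edist_coord _ _ _) tx.
    rewrite -bigcup_seq; exists e; first by rewrite /= mem_index_enum.
    by rewrite /cell_set /= xe ty.
  exact: (outer_measure_bigsetU (hausdorff_outer (@edist R k) alpha T1)).
have : ((size ys)%:R%:E * (c * scale l `^ alpha)%:E <= (3 ^+ k * c')%:E)%E.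
  apply: (@le_trans _ _ (\sum_(y <- ys) \sum_(e : {ffun 'I_k -> 'I_(1 + 1).+1})
      mu (cell_set l (shift y e)))%E).
    rewrite -EFinM mulr_natl -iter_addr_0 -count_predT -big_const_seq -sumEFin.
    by rewrite big_seq [leRHS]big_seq; apply: lee_sum => y; exact: muy.
  (* For a fixed offset the shifted cells are distinct, hence disjoint, with total measure at most
     c'; there are 3^k offsets. *)
  rewrite exchange_big/=.
  apply: (@le_trans _ _ (\sum_(e : {ffun 'I_k -> 'I_(1 + 1).+1}) c'%:E)%E).
    apply: lee_sum => e _; apply: le_trans mT.
    have := @sum_measure_cells R k alpha T1 l setT [seq shift y e | y <- ys] measurableT.
    rewrite map_inj_uniq; last exact: shift_inj.
    by move=> /(_ uys); rewrite big_map; under eq_bigr do rewrite setTI.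
  by rewrite sumEFin sumr_const card_ffun !card_ord lee_fin -[leLHS]mulr_natl natrX.
rewrite -EFinM lee_fin => h.
by rewrite -mulrA -invfM mulrC ler_pdivlMl ?mulr_gt0// ?powR_gt0// mulrC.
Qed.

Section borel_sets.
Context {X : topologicalType}.
Implicit Types A B : set X.

Lemma borel_open A : open A -> borel A.
Proof. exact: sub_sigma_algebra. Qed.

Lemma borel0 : borel (@set0 X).
Proof. by have [] := @smallest_sigma_algebra X setT [set U : set X | open U]. Qed.

Lemma borelC A : borel A -> borel (~` A).
Proof.
rewrite -setTD; have [_ + _] := @smallest_sigma_algebra X setT [set U : set X | open U].
exact.
Qed.

Lemma borel_bigcup (D : set nat) (F : nat -> set X) :
  (forall i, D i -> borel (F i)) -> borel (\bigcup_(i in D) F i).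
Proof.
move=> h; rewrite bigcup_mkcond.
have [_ _] := @smallest_sigma_algebra X setT [set U : set X | open U]; apply => i.
by case: ifPn => [/set_mem/h//|_]; exact: borel0.
Qed.

Lemma borelU A B : borel A -> borel B -> borel (A `|` B).
Proof.
move=> bA bB; rewrite -bigcup2E; apply: borel_bigcup => -[//|[//|i]] _; exact: borel0.
Qed.

Lemma borelI A B : borel A -> borel B -> borel (A `&` B).
Proof.
by move=> bA bB; rewrite -[_ `&` _]setCK setCI; apply: borelC; apply: borelU; exact: borelC.
Qed.

Lemma borelD A B : borel A -> borel B -> borel (A `\` B).
Proof. by move=> bA bB; rewrite setDE; apply: borelI => //; exact: borelC. Qed.

Lemma borel_closed A : closed A -> borel A.
Proof.
by move=> cA; rewrite -[A]setCK; apply: borelC; apply: borel_open; exact: closed_openC.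
Qed.

Lemma borel_bigcap (F : nat -> set X) :
  (forall i, borel (F i)) -> borel (\bigcap_i F i).
Proof.
move=> h; rewrite -[\bigcap__ _]setCK setC_bigcap.
by apply: borelC; apply: borel_bigcup => i _; exact: borelC.
Qed.

Lemma borel_bigsetU I (s : seq I) (F : I -> set X) :
  (forall i, borel (F i)) -> borel (\big[setU/set0]_(i <- s) F i).
Proof. by move=> h; elim/big_ind : _ => //; [exact: borel0|exact: borelU]. Qed.

End borel_sets.

Lemma lee_nneseries_tail (R : realType) (u v : nat -> \bar R) N :
  (forall i, (N <= i)%N -> 0 <= u i)%E -> (forall i, (N <= i)%N -> u i <= v i)%E ->
  (\sum_(N <= i <oo) u i <= \sum_(N <= i <oo) v i)%E.
Proof.
by move=> u0 uv; rewrite [leLHS]eseries_cond [leRHS]eseries_cond;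
  apply: lee_nneseries => [i _ /andP[_]|i /andP[_]]; [exact: u0|exact: uv].
Qed.

(** * Decomposition of one bounded piece *)

Section piece.
Context {R : realType} (k n : nat) (alpha b tau c c' r : R) (T T0 : set 'rV[R]_k)
  (t0 : 'rV[R]_k) (Kb : set 'rV[R]_k) (Kf : set 'rV[R]_n) (z : lattice n)
  (B : set ('rV[R]_k * 'rV[R]_n)).
Hypotheses (alpha_gt0 : 0 < alpha) (b_gt0 : 0 < b) (tau_gt0 : 0 < tau) (tau_le1 : tau <= 1).
Hypotheses (c_gt0 : 0 < c) (c'_gt0 : 0 < c').
Hypothesis regT : forall (t : 'rV[R]_k) (r : R), T t -> 0 < r -> r <= 1 ->
  ((c * r `^ alpha)%:E <=
     hausdorff_measure (@edist R k) alpha (T `&` eball t r))%E /\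
  (hausdorff_measure (@edist R k) alpha (T `&` eball t r) <=
     (c' * r `^ alpha)%:E)%E.
Hypotheses (Tt0 : T t0) (T0T : T0 `<=` T) (r_gt0 : 0 < r) (kr1 : k%:R * (r + r) < 1).
Hypothesis T0r : forall t i, T0 t -> `|t 0 i - t0 0 i| <= r.
Hypotheses (cKb : compact Kb) (cKf : compact Kf) (T0Kb : T0 `<=` Kb).
Hypothesis Kfz : forall x, Kf x -> cell 0 x = z.
Hypotheses (bB : borel B) (BK : B `<=` T0 `*` Kf).
Hypothesis B0 : forall t, hausdorff_measure (@edist R n) b [set x | B (t, x)] = 0%E.

Let T1 := T `&` eball t0 1.
Local Notation mu0 := (hausdorff_outer (@edist R k) alpha T1).
Local Notation mu := (hausdorff_cara (@edist R k) alpha T1).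

Let mu_fin : (mu setT < +oo)%E.
Proof.
rewrite hausdorff_caraE setTI.
by have [_ /le_lt_trans] := regT Tt0 ltr01 (lexx _); apply; exact: ltry.
Qed.

Let q : R := 2^-1 `^ tau.

Let q0 : 0 < q. Proof. by rewrite powR_gt0// invr_gt0. Qed.

Let q1 : q < 1.
Proof.
have -> : 1 = 1 `^ tau :> R by rewrite powR1.
by apply: gt0_ltr_powR; rewrite ?nnegrE//; lra.
Qed.

Let qE l : scale l `^ tau = q ^+ l. Proof. exact: scale_powR. Qed.

Let scale_le_q l : scale l <= q ^+ l.
Proof.
rewrite -qE; apply: ger1_powR => //; apply/andP; split=> //; exact: scale_le1.
Qed.

Let powD l (u v : R) : scale l `^ (u + v) = scale l `^ u * scale l `^ v.
Proof. by rewrite powRD//; apply/implyP => _; rewrite gt_eqF. Qed.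

(** At step [m] the content of [E m] is O(2^(-m)), and a Lipschitz graph runs through [B] outside
    [E m] over a set of measure O(q^m). Thus the limsup of the [E m] is null, and each tail of the
    complements is null along every graph. *)
Lemma piece_decomposition : exists G : set ('rV[R]_k * 'rV[R]_n),
  [/\ borel G, G `<=` B, Gamma_null alpha G &
    hausdorff_measure (@edist_prod R k n) (alpha + b + (tau + tau)) (B `\` G) = 0%E].
Proof.
set s := alpha + b + (tau + tau).
have [l0 hl0] := scale_lt r_gt0.
pose N m := (m + l0)%N.
have Nr l m : (N m <= l)%N -> scale l <= r.
  move=> Nl; apply: le_trans (ltW hl0); apply: scale_le.
  by rewrite (leq_trans _ Nl)// leq_addl.
(* This makes the covers of step [m] essentially start at level [N m]: the coarser
   cubes are used on a set of parameters of measure at most [scale m]. *)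
pose ep m : R := scale m * scale (N m) `^ b / (N m).+1%:R.
have ep0 m : 0 < ep m by rewrite divr_gt0 ?ltr0n// mulr_gt0// powR_gt0.
have ep_scale m : ep m <= scale m.
  rewrite /ep ler_pdivrMr ?ltr0n// ler_wpM2l//.
  rewrite (@le_trans _ _ 1) ?ler1n//.
  have -> : 1 = 1 `^ b :> R by rewrite powR1.
  by apply: ge0_ler_powR; rewrite ?nnegrE ?scale_le1// ltW.
have BKb : B `<=` Kb `*` Kf by move=> p /BK[? ?]; split=> //; exact: T0Kb.
have /choice[A AP] : forall m, exists A : node n -> set 'rV[R]_k,
    [/\ forall v, mu0.-cara.-measurable (A v),
    forall t x, B (t, x) -> exists l, A (node_of l x) t &
    forall l, (\sum_(v <- descendants (@child n) l (0%N, z)) mu (A v) <=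
      (ep m / scale l `^ b)%:E)%E].
  by move=> m; apply: (thin_cover b_gt0 mu_fin z cKb cKf bB BKb B0).
pose C1 : R := 3 ^+ k * c' / c.
have C10 : 0 <= C1 by rewrite divr_ge0 ?mulr_ge0 ?exprn_ge0// ltW.
have /choice[ys ysP] : forall l, exists ys : seq (lattice k), scale l <= r :> R -> [/\ uniq ys,
    forall t, T0 t -> cell l t \in ys,
    forall y, y \in ys -> exists2 t, T0 t & cell l t = y &
    (size ys)%:R <= C1 * (scale l `^ alpha)^-1].
  move=> l; have [lr|] := leP (scale l) r; last by exists [::].
  have [ys hys] := regular_cells c_gt0 regT Tt0 T0T kr1 T0r lr.
  by exists ys.
pose desc l := descendants (@child n) l (0%N, z).
pose full m l v y := ((scale l `^ (alpha + tau))%:E <= mu (A m v `&` cell_set l y))%E.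
pose box j l (y : lattice j) : set 'rV[R]_j :=
  [set x | forall i, (y i)%:~R * scale l <= x 0 i <= (y i + 1)%:~R * scale l].
have boxP j l (x : 'rV[R]_j) : box j l (cell l x) x.
  by move=> i; have /cellP/(_ i)/andP[-> /ltW ->] := erefl (cell l x).
have box_dist j l y (x x' : 'rV[R]_j) : box j l y x -> box j l y x' ->
    edist x x' <= j%:R * scale l.
  move=> yx yx'; apply: edist_le => // i; have := yx i; have := yx' i.
  by rewrite intrD mulrDl mul1r; move: ((_ : int)%:~R * _) => a; rewrite ler_norml; lra.
(* The sets [A m v] are only Carathéodory measurable. Fullness merely decides which closed boxes
   enter, so [El m l] is a finite union of closed sets and hence Borel. *)
pose El m l := \big[setU/set0]_(v <- desc l) \big[setU/set0]_(y <- ys l)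
  (if full m l v y then box k l y `*` box n l v.2 else set0).
have bEl m l : borel (El m l).
  apply: borel_bigsetU => v; apply: borel_bigsetU => y.
  case: ifP => _; last exact: borel0.
  apply: borel_closed; apply: closed_setM; apply: compact_closed_rV; exact: compact_box.
pose E m := B `&` \bigcup_(l in ~` `I_(N m)) El m l.
have bE m : borel (E m) by apply: borelI => //; apply: borel_bigcup.
pose Es := \bigcap_M \bigcup_m E (M + m)%N.
have bEs : borel Es by apply: borel_bigcap => M; apply: borel_bigcup.
have EsB : Es `<=` B by move=> p /(_ 0%N Logic.I)[m _ []].
exists (B `\` Es); split.
- exact: borelD.
- by move=> p [].
- move=> f [L Lf].
  (* Over a cell of side [scale l] each coordinate of [f] varies by at most [|L| * k * scale l],
     which is less than [a * scale l]. *)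
  pose a := (Num.truncn (`|L| * k%:R)).+1.
  pose Cf : R := C1 * ((a + a).+1 ^ n)%:R.
  have Cf0 : 0 <= Cf by rewrite mulr_ge0.
  (* The value of [f] at one point of [T0] in each cell locates the graph over the whole cell; [t0]
     is a dummy value elsewhere. *)
  have /choice[rep repP] : forall ly : nat * lattice k, exists t, scale ly.1 <= r :> R ->
      ly.2 \in ys ly.1 -> T0 t /\ cell ly.1 t = ly.2.
    move=> [l y]; have [lr|] := leP (scale l) r; last by exists t0.
    have [yl|] := boolP (y \in ys l); last by exists t0.
    by have [_ _ /(_ y yl)[t T0t ty] _] := ysP l lr; exists t.
  pose Nm m := [set t | (B `\` E m) (t, f t)].
  have NmT1 m : Nm m `<=` T1.
    move=> t [/BK[/= T0t _] _]; split; first exact: T0T.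
    rewrite /eball/= (@le_lt_trans _ _ (k%:R * r))//.
      by apply: edist_le => [|i]; [exact: ltW|rewrite distrC T0r].
    by apply: le_lt_trans kr1; rewrite ler_wpM2l// lerDl ltW.
  have bound m : (hausdorff_measure (@edist R k) alpha (Nm m) <=
      ((1 + Cf / (1 - q)) * q ^+ m)%:E)%E.
    rewrite -(setIidl (@NmT1 m)) -hausdorff_caraE.
    have [mA cA sA] := AP m.
    pose v l y (e : {ffun 'I_n -> 'I_(a + a).+1}) : node n := (l, shift (cell l (f (rep (l, y)))) e).
    pose P l := \big[setU/set0]_(y <- ys l) \big[setU/set0]_(e : {ffun 'I_n -> 'I_(a + a).+1})
      (if full m l (v l y e) y then set0 else A m (v l y e) `&` cell_set l y).
    pose Q := \big[setU/set0]_(l <- iota 0 (N m)) \big[setU/set0]_(w <- desc l) A m w.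
    (* The cover at [t] contains a cube around [f t]: it is either coarse, which puts [t] in [Q], or
       not full over the cell of [t], since otherwise [(t, f t)] would lie in [E m]. *)
    have cov : Nm m `<=` Q `|` \bigcup_(l in ~` `I_(N m)) P l.
      move=> t [Bt nE]; have [/= T0t Kft] := BK Bt.
      have [l Al] := cA t (f t) Bt.
      have dl : node_of l (f t) \in desc l.
        by have := mem_descendants l 0 (f t); rewrite /node_of (Kfz Kft).
      have [lN|Nl] := ltnP l (N m).
        left; rewrite /Q -bigcup_seq; exists l; first by rewrite /= mem_iota.
        by rewrite -bigcup_seq; exists (node_of l (f t)).
      right; exists l; first by rewrite /= /mkset; apply/negP; rewrite -leqNgt.
      have lr := Nr l m Nl.
      have [_ /(_ t T0t) tys _ _] := ysP l lr.
      have [T0rep crep] := repP (l, cell l t) lr tys.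
      have [|e he] := @cell_shift R n l (f t) (f (rep (l, cell l t))) a.
        move=> i; apply: le_lt_trans (edist_coord _ _ i) _.
        apply: le_lt_trans (Lf _ _) _.
        apply: (@le_lt_trans _ _ (`|L| * (k%:R * scale l))).
          apply: (@le_trans _ _ (`|L| * edist t (rep (l, cell l t)))).
            by rewrite ler_wpM2r ?edist_ge0// ler_norm.
          rewrite ler_wpM2l//; apply: edist_le => // i'.
          by apply: cell_eq_dist; rewrite crep.
        by rewrite mulrA ltr_pM2r// Num.Theory.truncnS_gt.
      rewrite /P -bigcup_seq; exists (cell l t) => //.
      rewrite -bigcup_seq; exists e; first by rewrite /= mem_index_enum.
      have ve : v l (cell l t) e = node_of l (f t) by rewrite /v -he.
      rewrite ve; case: ifPn => [fl|_]; last by split.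
      exfalso; apply: nE; split => //; exists l.
        by rewrite /= /mkset; apply/negP; rewrite -leqNgt.
      rewrite /El -bigcup_seq; exists (node_of l (f t)) => //.
      rewrite -bigcup_seq; exists (cell l t) => //.
      by rewrite fl; split; exact: boxP.
    apply: le_trans (le_outer_measure mu0 _ _ cov) _.
    apply: le_trans (outer_measureU2 mu0 _ _) _.
    have hQ : (mu0 Q <= (scale m)%:E)%E.
      apply: le_trans (outer_measure_bigsetU mu0 _ _) _.
      apply: (@le_trans _ _ (\sum_(l <- iota 0 (N m)) (scale m / (N m).+1%:R)%:E)%E).
        rewrite big_seq [leRHS]big_seq; apply: lee_sum => l; rewrite mem_iota add0n => /= lN.
        apply: le_trans (outer_measure_bigsetU mu0 _ _) _.
        apply: le_trans (sA l) _; rewrite lee_fin ler_pdivrMr ?powR_gt0//.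
        rewrite /ep mulrAC ler_wpM2l ?divr_ge0//.
        by apply: ge0_ler_powR; rewrite ?nnegrE ?(ltW b_gt0)//; apply: scale_le; exact: ltnW.
      rewrite sumEFin lee_fin big_const_seq count_predT size_iota iter_addr_0.
      rewrite -[leLHS]mulr_natl mulrA ler_pdivrMr ?ltr0n// mulrC ler_wpM2l//.
      by rewrite ler_nat.
    have hP : (mu0 (\bigcup_(l in ~` `I_(N m)) P l) <= (Cf * q ^+ N m / (1 - q))%:E)%E.
      apply: le_trans (outer_measure_sigma_subadditive_tail mu0 _ _) _.
      apply: le_trans (geometric_tail_le _ (ltW q0) q1 Cf0).
      apply: lee_nneseries_tail => l Nl; first exact: outer_measure_ge0.
      have lr := Nr l m Nl; have [_ _ _ sys] := ysP l lr.
      apply: le_trans (outer_measure_bigsetU mu0 _ _) _.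
      (* About [(scale l)^(-alpha)] cells, boundedly many cubes over each, and measure below
         [(scale l)^(alpha + tau)] for a non-full pair: the product is [Cf * q ^+ l]. *)
      apply: (@le_trans _ _ (\sum_(y <- ys l) \sum_(e : {ffun 'I_n -> 'I_(a + a).+1})
          (scale l `^ (alpha + tau))%:E)%E).
        apply: lee_sum => y _; apply: le_trans (outer_measure_bigsetU mu0 _ _) _.
        apply: lee_sum => e _; case: ifPn; last by rewrite -ltNge => /ltW.
        by rewrite outer_measure0 lee_fin powR_ge0.
      under eq_bigr do rewrite sumEFin sumr_const card_ffun !card_ord.
      rewrite sumEFin lee_fin big_const_seq count_predT iter_addr_0 powD qE -[leLHS]mulr_natl.
      rewrite -[X in _ * X <= _]mulr_natl.
      rewrite /Cf; set K := (_ ^ _)%N.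
      have -> : (size (ys l))%:R * (K%:R * (scale l `^ alpha * q ^+ l)) =
        ((size (ys l))%:R * scale l `^ alpha) * (K%:R * q ^+ l) by ring.
      rewrite -[leRHS]mulrA ler_wpM2r ?mulr_ge0 ?exprn_ge0 ?(ltW q0)//.
      by rewrite -ler_pdivlMr// powR_gt0.
    apply: le_trans (leeD hQ hP) _; rewrite -EFinD lee_fin mulrDl mul1r.
    apply: lerD; first exact: scale_le_q.
    rewrite mulrAC ler_wpM2l ?divr_ge0 ?subr_ge0 ?(ltW q1)//.
    by apply: ler_wiXn2l; rewrite ?(ltW q0) ?(ltW q1)// leq_addr.
  apply/eqP; rewrite eq_le hausdorff_measure_ge0 andbT.
  (* Outside the limsup, a point avoids all [E (M + m)] from some [M] on. *)
  apply: (@le_trans _ _ (hausdorff_measure (@edist R k) alpha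
      (\bigcup_M \bigcap_m Nm (M + m)%N))).
    apply: le_hausdorff_measure => t [Bt /existsNP[M /not_implyP[_ nM]]].
    by exists M => // m _; split=> // Em; apply: nM; exists m.
  apply: le_trans (hausdorff_sigma_subadditive _ _ _) _.
  rewrite eseries0// => M _ _.
  apply/eqP; rewrite eq_le hausdorff_measure_ge0 andbT.
  apply/lee_addgt0Pr => e e0; rewrite add0e.
  pose C2 := 1 + Cf / (1 - q).
  have C20 : 0 < C2 by rewrite ltr_wpDr// divr_ge0// subr_ge0 ltW.
  have [m hm] := expr_lt_exists (ltW q0) q1 (divr_gt0 e0 C20).
  apply: (@le_trans _ _ (hausdorff_measure (@edist R k) alpha (Nm (M + m)%N))).
    by apply: le_hausdorff_measure => t; apply.
  apply: le_trans (bound _) _; rewrite lee_fin mulrC -ler_pdivlMr//.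
  apply: le_trans (ltW hm); apply: ler_wiXn2l; rewrite ?(ltW q0) ?(ltW q1)//.
  exact: leq_addl.
- rewrite (_ : B `\` _ = Es); last by rewrite setDD setIC setIidl.
  have s0 : 0 <= s by rewrite !addr_ge0// ltW.
  pose Kc : R := k%:R + n%:R.
  have Kc0 : 0 <= Kc by rewrite addr_ge0.
  pose C3 := Kc `^ s / (1 - q).
  have C30 : 0 <= C3 by rewrite divr_ge0 ?powR_ge0// subr_ge0 ltW.
  apply: hausdorff_measure_eq0 => delta e d0 e0.
  pose pm := posnum_premeasure (@edist_prod R k n) s (PosNum d0).
  have bound m : Kc * scale (N m) <= delta -> (pm (E m) <= (C3 * scale m)%:E)%E.
    move=> Kd; have [mA cA sA] := AP m.
    apply: (@le_trans _ _ (pm (\bigcup_(l in ~` `I_(N m)) El m l))).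
      by apply: le_premeasure => p [].
    apply: le_trans (outer_measure_sigma_subadditive_tail pm _ _) _.
    have K0 : 0 <= Kc `^ s * ep m by rewrite mulr_ge0 ?powR_ge0// ltW.
    apply: (@le_trans _ _ ((Kc `^ s * ep m) * q ^+ (N m) / (1 - q))%:E); last first.
      rewrite lee_fin (_ : _ / (1 - q) = C3 * (ep m * q ^+ N m)); last by rewrite /C3; ring.
      rewrite ler_wpM2l// -[leRHS]mulr1; apply: ler_pM => //.
      - exact: ltW.
      - by rewrite exprn_ge0// ltW.
      - by rewrite exprn_ile1// ltW.
    apply: le_trans (geometric_tail_le _ (ltW q0) q1 K0).
    apply: lee_nneseries_tail => l Nl; first exact: premeasure_ge0.
    have [uys _ _ _] := ysP l (Nr l m Nl).
    (* The price per unit of measure: the s-th power of the diameter bound of a box is [h] times the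
       fullness threshold, hence at most [h] times the measure over that cell. The factor with
       exponent tau in [h] makes the sum over levels geometric. *)
    pose h := Kc `^ s * scale l `^ (b + tau).
    have h0 : 0 <= h by rewrite mulr_ge0 ?powR_ge0.
    apply: le_trans (outer_measure_bigsetU pm _ _) _.
    apply: (@le_trans _ _ (\sum_(v <- desc l) h%:E * mu (A m v))%E).
      apply: lee_sum => v _.
      apply: le_trans (outer_measure_bigsetU pm _ _) _.
      apply: (@le_trans _ _ (\sum_(y <- ys l) h%:E * mu (A m v `&` cell_set l y))%E).
        apply: lee_sum => y _; case: ifPn => [fl|_]; last first.
          by rewrite outer_measure0 mule_ge0// measure_ge0.
        have dbox : (diam (@edist_prod R k n) (box k l y `*` box n l v.2) <= (Kc * scale l)%:E)%E.
          apply: diam_le; first by rewrite mulr_ge0.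
          move=> p p' [p1 p2] [p1' p2']; rewrite mulrDl.
          by apply: edist_prod_le; rewrite ?mulr_ge0//; [exact: box_dist p1 p1'|exact: box_dist p2 p2'].
        apply: (@le_trans _ _ ((Kc * scale l) `^ s)%:E).
          apply: le_trans (diam_pow_le s0 dbox).
          apply: premeasure_le_diam; first exact: ltW.
          apply: le_trans dbox _; rewrite lee_fin; apply: le_trans Kd.
          by rewrite ler_wpM2l// scale_le.
        apply: (@le_trans _ _ (h%:E * (scale l `^ (alpha + tau))%:E)%E).
          rewrite -EFinM lee_fin powRM// /h -mulrA -powD.
          by rewrite (_ : b + tau + (alpha + tau) = s)// /s; ring.
        by rewrite lee_wpmul2l.
      rewrite -ge0_sume_distrr; last by move=> y _; exact: measure_ge0.
      by rewrite lee_wpmul2l//; exact: sum_measure_cells.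
    rewrite -ge0_sume_distrr; last by move=> y _; exact: measure_ge0.
    apply: (@le_trans _ _ (h%:E * (ep m / scale l `^ b)%:E)%E).
      by rewrite lee_wpmul2l// sA.
    rewrite -EFinM lee_fin /h powD qE.
    have w0 : scale l `^ b != 0 :> R by rewrite gt_eqF// powR_gt0.
    rewrite le_eqVlt; apply/orP; left; apply/eqP; field.
    exact: w0.
  have C31 : 0 < 2 * C3 + 1 by lra.
  (* The first bound makes the boxes finer than [delta]; the second makes the tail of the contents,
     at most [2 * C3 * scale M], smaller than [e]. Adding 1 keeps the denominators positive. *)
  have [M hM] : exists M, scale M < Num.min (delta / (Kc + 1)) (e / (2 * C3 + 1)).
    by apply: scale_lt; rewrite lt_min !divr_gt0// ltr_wpDl.
  move: hM; rewrite lt_min => /andP[hM1 hM2].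
  apply: (@le_trans _ _ (pm (\bigcup_m E (M + m)%N))).
    by apply: le_premeasure => p /(_ M Logic.I).
  apply: le_trans (outer_measure_sigma_subadditive pm _) _.
  have half : 0 <= 2^-1 :> R by rewrite invr_ge0.
  have half1 : 2^-1 < 1 :> R by lra.
  apply: (@le_trans _ _ (\sum_(m <oo) (C3 * scale M * 2^-1 ^+ m)%:E)%E).
    apply: lee_nneseries => [m _ _|m _]; first exact: premeasure_ge0.
    rewrite -mulrA -exprD; apply: bound.
    move: hM1; rewrite ltr_pdivlMr ?ltr_wpDl// => hM1; apply: le_trans (ltW hM1).
    rewrite mulrC; apply: ler_pM => //; last by rewrite lerDl.
    by apply: scale_le; rewrite /N -addnA leq_addr.
  have C3M : 0 <= C3 * scale M by apply: mulr_ge0; [exact: C30|].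
  apply: le_trans (geometric_tail_le _ half half1 C3M) _.
  rewrite lee_fin expr0 mulr1 (_ : (1 - 2^-1)^-1 = 2 :> R); last by field.
  move: hM2; rewrite ltr_pdivlMr// => hM2; apply: le_trans (ltW hM2).
  have := scale_ge0 (R := R) M; lra.
Qed.

End piece.

(** * Countable assembly of the pieces *)

Lemma hausdorff_bigcup_eq0 (R : realType) (X : Type) (d : X -> X -> R) s
    (I : countType) (F : I -> set X) :
  (forall i, hausdorff_measure d s (F i) = 0%E) ->
  hausdorff_measure d s (\bigcup_i F i) = 0%E.
Proof.
move=> F0; apply/eqP; rewrite eq_le hausdorff_measure_ge0 andbT.
pose F' m := if unpickle m is Some i then F i else set0.
apply: (@le_trans _ _ (hausdorff_measure d s (\bigcup_m F' m))).
  apply: le_hausdorff_measure => x [i _ Fx].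
  by exists (pickle i) => //; rewrite /F' pickleK.
apply: le_trans (hausdorff_sigma_subadditive _ _ _) _.
rewrite eseries0// => m _ _; rewrite /F'; case: unpickle => //.
exact: hausdorff_measure0.
Qed.

Lemma borel_bigcup_count (X : topologicalType) (I : countType) (F : I -> set X) :
  (forall i, borel (F i)) -> borel (\bigcup_i F i).
Proof.
move=> bF; rewrite (_ : \bigcup_i F i =
    \bigcup_m (if unpickle m is Some i then F i else set0)).
  by apply: borel_bigcup => m _; case: unpickle => //; exact: borel0.
apply/seteqP; split=> [x [i _ Fx]|x [m _]].
  by exists (pickle i) => //; rewrite pickleK.
by case: unpickle => // i Fx; exists i.
Qed.

(** Exhausts a half-open unit cell by compact boxes, so that fibres can be compactly contained while
    staying under a single root. *)
Lemma cell_interior (R : realType) n (x : 'rV[R]_n) : exists q : nat, forall i,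
  (cell 0 x i)%:~R <= x 0 i <= (cell 0 x i + 1)%:~R - q.+1%:R^-1.
Proof.
have x01 i : (cell 0 x i)%:~R <= x 0 i < (cell 0 x i + 1)%:~R.
  by have /cellP/(_ i) := erefl (cell 0 x); rewrite /scale expr0 !mulr1.
have /choice[q qP] : forall i, exists q : nat, x 0 i <= (cell 0 x i + 1)%:~R - q.+1%:R^-1.
  move=> i; have /andP[_ xi] := x01 i.
  exists (Num.truncn ((cell 0 x i + 1)%:~R - x 0 i)^-1).
  rewrite lerBrDl -lerBrDr invf_ple ?posrE ?ltr0n ?subr_gt0//.
  exact/ltW/Num.Theory.truncnS_gt.
exists (\max_i q i)%N => i; have /andP[-> _] := x01 i.
apply: le_trans (qP i) _; rewrite lerD2l lerN2 lef_pV2 ?posrE ?ltr0n//.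
by rewrite ler_nat ltnS leq_bigmax.
Qed.

Theorem theorem2p14 (R : realType) (n k : nat) (hn : (1 <= n)%N)
    (hk : (1 <= k)%N) (alpha : R) (halpha0 : 0 < alpha)
    (halphak : alpha <= k%:R) (T : set 'rV[R]_k) (hT : AD_regular alpha T)
    (B : set ('rV[R]_k * 'rV[R]_n)) (hBT : B `<=` T `*` setT)
    (hB : borel B) (beta : R) (hbeta0 : 0 < beta) (hbetan : beta <= n%:R)
    (hdim : forall t : 'rV[R]_k, T t ->
       (hausdorff_dim (@edist R n) [set x | B (t, x)] <= beta%:E)%E) :
  exists G : set ('rV[R]_k * 'rV[R]_n),
    [/\ borel G, G `<=` B, Gamma_null alpha G &
      (hausdorff_dim (@edist_prod R k n) (B `\` G) <= (alpha + beta)%:E)%E].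
Proof.
have [bT [c [c' [c0 c'0 regT]]]] := hT.
(* Here r = 1/(4(k+1)), so that 2kr < 1. *)
pose r : R := (2 * k.+1%:R)^-1 / 2.
have k0 : 0 < 2 * k.+1%:R :> R by rewrite mulr_gt0// ltr0n.
have r0 : 0 < r by rewrite divr_gt0// invr_gt0.
have kr1 : k%:R * (r + r) < 1.
  rewrite /r -splitr ltr_pdivrMr// mul1r -natrM ltr_nat; lia.
have [p /ltW pr] := scale_lt r0.
pose tau j : R := j.+1%:R^-1.
have tau0 j : 0 < tau j by rewrite invr_gt0 ltr0n.
have tau1 j : tau j <= 1 by rewrite invf_le1 ?ltr0n// ler1n.
pose Kb (y : lattice k) := [set t : 'rV[R]_k | forall i,
  (y i)%:~R * scale p <= t 0 i <= (y i + 1)%:~R * scale p].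
pose Kf (z : lattice n) (q : nat) := [set x : 'rV[R]_n | forall i,
  (z i)%:~R <= x 0 i <= (z i + 1)%:~R - q.+1%:R^-1].
pose Bp y z q := B `&` (Kb y `*` Kf z q).
pose idx := (lattice k * lattice n * nat * nat)%type.
have /choice[G GP] : forall i : idx, exists G : set ('rV[R]_k * 'rV[R]_n),
    [/\ borel G, G `<=` Bp i.1.1.1 i.1.1.2 i.1.2, Gamma_null alpha G &
    hausdorff_measure (@edist_prod R k n)
      (alpha + (beta + tau i.2) + (tau i.2 + tau i.2))
      (Bp i.1.1.1 i.1.1.2 i.1.2 `\` G) = 0%E].
  move=> [[[y z] q] j] /=; pose T0 := T `&` Kb y.
  (* A nonempty base supplies the centre [t0] of the unit ball; otherwise the piece itself is
     empty. *)
  have [T0e|/set0P[t0 [Tt0 Kt0]]] := eqVneq T0 set0.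
    exists set0; split=> //; first exact: borel0.
      by move=> f _; rewrite hausdorff_measure0.
    rewrite setD0 (_ : Bp y z q = set0) ?hausdorff_measure0//.
    apply/seteqP; split=> // -[t x] [/hBT[Tt _] [Kt _]].
    by have : T0 t by []; rewrite T0e.
  apply: (@piece_decomposition R k n alpha (beta + tau j) (tau j) c c' r T T0 t0
    (Kb y) (Kf z q) z (Bp y z q)) => //.
  - exact: addr_gt0.
  - by move=> t [].
  - move=> t i [_ Kt]; have := Kt i; have := Kt0 i; rewrite intrD mulrDl mul1r.
    by move: ((_ : int)%:~R * _) => a; rewrite ler_norml; lra.
  - exact: compact_box.
  - exact: compact_box.
  - by move=> t [].
  - move=> x Kx; apply/cellP => i; have /andP[zx h] := Kx i.
    rewrite /scale expr0 !mulr1 zx/=; apply: le_lt_trans h _.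
    by rewrite ltrBlDr ltrDl invr_gt0 ltr0n.
  - apply: borelI => //; apply: borel_closed; apply: closed_setM;
      apply: compact_closed_rV; exact: compact_box.
  - by move=> [t x] [/hBT[Tt _] [Kt Kx]].
  - move=> t; have [Tt|nTt] := pselect (T t); last first.
      rewrite (_ : [set x | _] = set0) ?hausdorff_measure0//.
      by apply/seteqP; split=> // x [/hBT[]].
    apply/eqP; rewrite eq_le hausdorff_measure_ge0 andbT.
    rewrite -(@hausdorff_dim_lt _ _ (@edist R n) (beta + tau j) [set x | B (t, x)]).
      by apply: le_hausdorff_measure => x [].
    by apply: le_lt_trans (hdim t Tt) _; rewrite lte_fin ltrDl.
(* The union runs over the pieces and over all values [tau j]: it stays Gamma-null, and enlarging
   [G] only shrinks the remainder. *)
exists (\bigcup_i G i); split.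
- by apply: borel_bigcup_count => i; have [] := GP i.
- by move=> x [i _ Gx]; have [_ /(_ x Gx)[]] := GP i.
- move=> f Lf; rewrite (_ : [set t | _] = \bigcup_i [set t | G i (t, f t)]); last first.
    by apply/seteqP; split=> t [i _ Gt]; exists i.
  by apply: hausdorff_bigcup_eq0 => i; have [_ _ ->] := GP i.
- apply/lee_addgt0Pr => e e0.
  pose j := Num.truncn (3 / e); have tauj : 3 * tau j <= e.
    rewrite ler_pdivrMr ?ltr0n// mulrC -ler_pdivrMr//.
    exact/ltW/Num.Theory.truncnS_gt.
  apply: (@le_trans _ _ (alpha + (beta + tau j) + (tau j + tau j))%:E); last first.
    by rewrite -EFinD lee_fin; lra.
  apply: hausdorff_dim_le; first by rewrite !addr_ge0// ltW.
  apply/eqP; rewrite eq_le hausdorff_measure_ge0 andbT.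
  (* For this fixed [j] the remainder lies in the union over the pieces of the null sets [Bp] minus
     [G (i, j)]. *)
  rewrite -(@hausdorff_bigcup_eq0 R _ (@edist_prod R k n)
    (alpha + (beta + tau j) + (tau j + tau j)) (lattice k * lattice n * nat)%type
    (fun i => Bp i.1.1 i.1.2 i.2 `\` G (i, j))); last first.
    by move=> [[y z] q]; have [] := GP (y, z, q, j).
  apply: le_hausdorff_measure => -[t x] [Btx nG].
  have [q xq] := cell_interior x.
  exists (cell p t, cell 0 x, q) => //=; split; last first.
    by move=> Gtx; apply: nG; exists (cell p t, cell 0 x, q, j).
  split=> //; split=> //= i.
  by have /cellP/(_ i)/andP[-> /ltW ->] := erefl (cell p t).
Qed.
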